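(* Let $\mathcal{A}$ be a finite alphabet and let $\mathbf{p},\mathbf{q}$ be irreducible pairs on $\mathcal{A}$ which are piece-wise order reversing and have the same Type. If $\mathcal{P}(\mathbf{p})=\mathcal{P}(\mathbf{q})$, then the non-labeled extended Rauzy classes of $\mathbf{p}$ and $\mathbf{q}$ coincide.
   Context: Let $n=\#\mathcal{A}\ge2$. A pair is $\mathbf{p}=(p_0,p_1)$ with $p_0,p_1:\mathcal{A}\to\{1,\dots,n\}$ bijections (row $\varepsilon$ lists $p_\varepsilon^{-1}(1),\dots,p_\varepsilon^{-1}(n)$). Irreducible: $p_0^{-1}\{1,\dots,k\}\ne p_1^{-1}\{1,\dots,k\}$ for $1\le k<n$. Rauzy move of type $\varepsilon$: $\varepsilon\mathbf{p}=(p'_0,p'_1)$, $p'_\varepsilon=p_\varepsilon$, and for $z=p_\varepsilon^{-1}(n)$, $p'_{1-\varepsilon}(b)=p_{1-\varepsilon}(b)$ if $p_{1-\varepsilon}(b)\le p_{1-\varepsilon}(z)$, $=p_{1-\varepsilon}(b)+1$ if $p_{1-\varepsilon}(z)<p_{1-\varepsilon}(b)<n$, $=p_{1-\varepsilon}(z)+1$ if $p_{1-\varepsilon}(b)=n$. Left Rauzy move of type $\varepsilon$: $\tilde\varepsilon\mathbf{p}=(p'_0,p'_1)$, $p'_\varepsilon=p_\varepsilon$, and for $a=p_\varepsilon^{-1}(1)$, $p'_{1-\varepsilon}(b)=p_{1-\varepsilon}(a)-1$ if $p_{1-\varepsilon}(b)=1$, $=p_{1-\varepsilon}(b)-1$ if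 $1<p_{1-\varepsilon}(b)<p_{1-\varepsilon}(a)$, $=p_{1-\varepsilon}(b)$ otherwise. The labeled extended Rauzy class of $\mathbf{p}$ is the set of pairs reachable from $\mathbf{p}$ by Rauzy and left Rauzy moves of both types; the non-labeled extended Rauzy class is its image under $(p_0,p_1)\mapsto p_1\circ p_0^{-1}\in\mathfrak{S}_n$. Define $\mathcal{S}(\mathbf{p}):\mathcal{A}\to\mathcal{A}$ by $\mathcal{S}(\mathbf{p})(\alpha)=p_0^{-1}(1)$ if $p_1(\alpha)=1$; $=p_0^{-1}(p_0(p_1^{-1}(n))+1)$ if $p_1(\alpha)=p_1(p_0^{-1}(n))+1$; $=p_0^{-1}(p_0(p_1^{-1}(p_1(\alpha)-1))+1)$ otherwise. $\mathcal{Y}(\mathbf{p})$ is the first return of $\mathcal{S}(\mathbf{p})$ to $\mathcal{A}\setminus\{p_0^{-1}(1)\}$, and $\mathcal{P}(\mathbf{p})$ is the unordered list with multiplicity of the cycle lengths of $\mathcal{Y}(\mathbf{p})$. Standard: $p_0^{-1}(1)=p_1^{-1}(n)$, $p_1^{-1}(1)=p_0^{-1}(n)$. A standard pair is piece-wise order reversing if there are $2=k_0<\dots<k_\ell=n$ with $B_i=p_0^{-1}\{k_{i-1},\dots,k_i-1\}=p_1^{-1}\{k_{i-1},\dots,k_i-1\}$ and $p_0(b)+p_1(b)=k_{i-1}+k_i-1$ for $b\in B_i$; the $B_i$ are blocks ($k$-block: $k$ letters). Chains: with the $1$-blocks $S_1,\dots,S_{k-1}$ listed left to right, chain $C_i$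 is the possibly empty sequence of consecutive blocks strictly between $S_{i-1}$ and $S_i$ ($C_1$ before $S_1$, $C_k$ after $S_{k-1}$). Types: $\langle1\rangle$: at most one nonempty chain, consisting (if present) of one block. Types $\langle2\rangle$–$\langle5\rangle$ require more than one block of size $\ge2$, and: $\langle2\rangle$: all nonempty chains consist of $2$-blocks; $\langle3\rangle$: each nonempty chain is (i) $m$ $2$-blocks, a $3$-block, $\ell$ $2$-blocks ($m,\ell\ge0$) or (ii) $m\ge1$ $2$-blocks, with at least one chain of form (i); $\langle4\rangle$: exactly one chain is a $4$-block followed by $m\ge0$ $2$-blocks, other nonempty chains consist of $2$-blocks; $\langle5\rangle$: exactly one chain is a single $5$-block, every other nonempty chain is exactly one $2$-block. *)

(* Defs.v *)
From mathcomp Require Import all_boot.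
Set Implicit Arguments. Unset Strict Implicit. Unset Printing Implicit Defensive.

Section Rauzy.
Variable A : finType.

(* A pair p = (p_0, p_1), each p_eps : A -> nat. *)
Definition pair := ((A -> nat) * (A -> nat))%type.

Local Notation n := #|A|.

Definition bij1n (f : A -> nat) : Prop :=
  injective f /\ forall a, 1 <= f a <= n.

Definition is_pair (p : pair) : Prop := bij1n p.1 /\ bij1n p.2.

Definition inv (f : A -> nat) (k : nat) : option A := [pick a | f a == k].
Definition invd (f : A -> nat) (k : nat) (d : A) : A := odflt d (inv f k).

Definition irreducible (p : pair) : Prop :=
  forall k, 1 <= k < n -> exists a, (p.1 a <= k) != (p.2 a <= k).

(* new row 1-eps of a Rauzy move of type eps; pe = p_eps, po = p_{1-eps} *)
Definition rmove_row (pe po : A -> nat) : A -> nat :=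
  match inv pe n with
  | Some z => fun b =>
      if po b <= po z then po b
      else if po b < n then (po b).+1
      else (po z).+1
  | None => po
  end.

Definition lmove_row (pe po : A -> nat) : A -> nat :=
  match inv pe 1 with
  | Some a => fun b =>
      if po b == 1 then (po a).-1
      else if po b < po a then (po b).-1
      else po b
  | None => po
  end.

(* eps = false is type 0, eps = true is type 1 *)
Definition rauzy (eps : bool) (p : pair) : pair :=
  if eps then (rmove_row p.2 p.1, p.2) else (p.1, rmove_row p.1 p.2).

Definition lrauzy (eps : bool) (p : pair) : pair :=
  if eps then (lmove_row p.2 p.1, p.2) else (p.1, lmove_row p.1 p.2).

Inductive ext_reach (p : pair) : pair -> Prop :=
  | ext_refl : ext_reach p p
  | ext_rauzy q eps : ext_reach p q -> ext_reach p (rauzy eps q)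
  | ext_lrauzy q eps : ext_reach p q -> ext_reach p (lrauzy eps q).

(* the permutation p_1 o p_0^{-1} of {1..n}, as the list of its values at 1..n *)
Definition nonlab (p : pair) : seq nat :=
  [seq p.2 a | a <- pmap (inv p.1) (iota 1 n)].

Definition nonlab_class (p : pair) : seq nat -> Prop :=
  fun s => exists2 q, ext_reach p q & nonlab q = s.

Definition Smap (p : pair) (al : A) : A :=
  if p.2 al == 1 then invd p.1 1 al
  else if p.2 al == (p.2 (invd p.1 n al)).+1 then
    invd p.1 (p.1 (invd p.2 n al)).+1 al
  else invd p.1 (p.1 (invd p.2 (p.2 al).-1 al)).+1 al.

(* Y(p): first return of S(p) to A \ {p_0^{-1}(1)} (letters x with p_0 x != 1);
   set to the identity on p_0^{-1}(1), which is outside its domain *)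
Definition Ymap (p : pair) (al : A) : A :=
  if p.1 al == 1 then al
  else head al [seq y <- [seq iter k (Smap p) al | k <- iota 1 n] | p.1 y != 1].

(* P(p): list (with multiplicity) of the cycle lengths of Y(p) on A \ {p_0^{-1}(1)},
   one entry per cycle (cycle represented by its froot) *)
Definition cycle_lengths (p : pair) : seq nat :=
  [seq order (Ymap p) x | x <- enum A & (p.1 x != 1) && (froot (Ymap p) x == x)].

Definition standard (p : pair) : Prop :=
  forall a, (p.1 a == 1) = (p.2 a == n) /\ (p.2 a == 1) = (p.1 a == n).

Definition pwor_witness (p : pair) (ks : seq nat) : Prop :=
  [/\ sorted ltn ks, head 0 ks = 2, last 0 ks = n &
      forall i, i.+1 < size ks -> forall b,
        let lo := nth 0 ks i in let hi := nth 0 ks i.+1 in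
        ((lo <= p.1 b < hi) = (lo <= p.2 b < hi)) /\
        (lo <= p.1 b < hi -> p.1 b + p.2 b = lo + hi - 1)].

Definition block_sizes (ks : seq nat) : seq nat :=
  [seq nth 0 ks i.+1 - nth 0 ks i | i <- iota 0 (size ks).-1].

(* chains: the (possibly empty) maximal runs of blocks between consecutive
   1-blocks (block sizes listed left to right) *)
Fixpoint chains (s : seq nat) : seq (seq nat) :=
  match s with
  | [::] => [:: [::]]
  | x :: s' =>
      if x == 1 then [::] :: chains s'
      else match chains s' with
           | c :: cs => (x :: c) :: cs
           | [::] => [:: [:: x]]
           end
  end.

Inductive PType := T1 | T2 | T3 | T4 | T5.

Definition all2s (c : seq nat) : bool := all (fun x => x == 2) c.
Definition form3i (c : seq nat) : bool :=
  (count (fun x => x == 3) c == 1) && all (fun x => (x == 2) || (x == 3)) c.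
Definition form3ii (c : seq nat) : bool := (c != [::]) && all2s c.
Definition form4 (c : seq nat) : bool :=
  if c is x :: t then (x == 4) && all2s t else false.

Definition has_type_sizes (t : PType) (s : seq nat) : bool :=
  let cs := chains s in
  let many := 1 < count (fun x => 2 <= x) s in
  match t with
  | T1 => (count (fun c => c != [::]) cs <= 1) &&
          all (fun c => (c == [::]) || (size c == 1)) cs
  | T2 => many && all all2s cs
  | T3 => [&& many, all (fun c => (c == [::]) || form3i c || form3ii c) cs
              & has form3i cs]
  | T4 => [&& many, count form4 cs == 1 & all (fun c => form4 c || all2s c) cs]
  | T5 => [&& many, count (fun c => c == [:: 5]) cs == 1 &
              all (fun c => (c == [:: 5]) || (c == [::]) || (c == [:: 2])) cs]
  end.

Definition pwor_of_type (p : pair) (t : PType) : Prop :=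
  standard p /\ exists2 ks, pwor_witness p ks & has_type_sizes t (block_sizes ks).

End Rauzy.

(* Main.v *)
Require Import Defs.
From mathcomp Require Import all_boot.
From mathcomp Require Import zify.

(** A standard piece-wise order reversing pair is determined, up to relabeling,
    by its sequence of block sizes.  Rauzy moves compose to rotations: if a row
    ends (starts) with x, then the part of the other row following (preceding) x
    can be rotated arbitrarily.  Such rotations carry along factors whose top and
    bottom words are arbitrary, which gives identities between words with opaque
    factors: chains can be permuted; [4 X 1 2 2 Y] can be turned into
    [2 2 X 1 4 Y]; and, after the 2-blocks of a chain have been moved one by one
    to another place, the outer exponents of [2^m 3 N 3 2^l] and of [2^m 3 2^l]
    can be exchanged.

    On the other side, following Y from a position until it returns to its left,
    one computes the cycle lengths block by block: a chain [2^m] has the cycle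
    length 2m+1, a chain [2^m 3 2^l] the lengths 2m+2 and 2l+2, a chain [4 2^m]
    the length 2m+5.  Hence equal lists of cycle lengths mean the same chains, up
    to the pairing of the exponents in the chains with a 3-block and up to the
    place of the 4-block, which the identities account for. *)

Set Implicit Arguments. Unset Strict Implicit. Unset Printing Implicit Defensive.

(** * Two-row words and the rotations generated by Rauzy moves *)

(** Symmetry is derived below, a rotation being undone by a rotation; thus only these constructors
    have to be realized by moves on pairs. *)
Inductive weq (T : Type) : seq T * seq T -> seq T * seq T -> Prop :=
| weq_refl u : weq u u
| weq_trans u v w : weq u v -> weq v w -> weq u w
| weq_swap t b t' b' : weq (t, b) (t', b') -> weq (b, t) (b', t')
| weq_right t x P Q1 Q2 :
    weq (rcons t x, P ++ x :: Q1 ++ Q2) (rcons t x, P ++ x :: Q2 ++ Q1)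
| weq_left t x P1 P2 Q :
    weq (x :: t, P1 ++ P2 ++ x :: Q) (x :: t, P2 ++ P1 ++ x :: Q).

Definition map2w (T T' : Type) (f : T -> T') (u : seq T * seq T) :=
  (map f u.1, map f u.2).

Lemma weq_sym (T : Type) (u v : seq T * seq T) : weq u v -> weq v u.
Proof.
elim=> [w|w1 w2 w3 _ h1 _ h2|t b t' b' _ h|t x P Q1 Q2|t x P1 P2 Q].
- exact: weq_refl.
- exact: weq_trans h2 h1.
- exact: weq_swap.
- exact: weq_right.
- exact: weq_left.
Qed.

Lemma weq_map (T T' : Type) (f : T -> T') u v :
  weq u v -> weq (map2w f u) (map2w f v).
Proof.
elim=> [w|w1 w2 w3 _ h1 _ h2|t b t' b' _ h|t x P Q1 Q2|t x P1 P2 Q].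
- exact: weq_refl.
- exact: weq_trans h1 h2.
- exact: weq_swap.
- by rewrite /map2w /= !map_rcons !map_cat /= !map_cat; apply: weq_right.
- by rewrite /map2w /= !map_cat /=; apply: weq_left.
Qed.

Lemma weq_perm (T : eqType) (u v : seq T * seq T) :
  weq u v -> perm_eq u.1 v.1 /\ perm_eq u.2 v.2.
Proof.
elim=> [w|w1 w2 w3 _ [h1 h2] _ [h3 h4]|t b t' b' _ [h1 h2]|t x P Q1 Q2
  |t x P1 P2 Q] //=.
- by split; [exact: perm_trans h1 h3|exact: perm_trans h2 h4].
- by rewrite perm_refl perm_cat2l perm_cons perm_catC.
- by rewrite perm_refl perm_catCA.
Qed.

(** * Rotation moves on words with opaque factors *)

(* [inl i] stands for a letter, [inr j] for a factor whose top and bottom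
   words are arbitrary and unrelated. *)
Notation token := (nat + nat)%type.

Definition rot_right (k : nat) (t b : seq token) : seq token :=
  if t is x0 :: t' then
    if last x0 t' is inl i then
      let m := (index (inl i : token) b).+1 in take m b ++ rot k (drop m b)
    else b
  else b.

Definition rot_left (k : nat) (t b : seq token) : seq token :=
  if t is inl i :: _ then
    let m := index (inl i : token) b in
    if inl i \in b then rot k (take m b) ++ drop m b else b
  else b.

(** Codes 0 and 1 rotate the bottom row at the last, respectively first, letter of the top row;
    codes 2 and 3 do the same with the rows exchanged. The second number counts tokens. *)
Definition exec (s : seq token * seq token) (m : nat * nat) :=
  match m.1 with
  | 0 => (s.1, rot_right m.2 s.1 s.2)
  | 1 => (s.1, rot_left m.2 s.1 s.2)
  | 2 => (rot_right m.2 s.2 s.1, s.2)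
  | _ => (rot_left m.2 s.2 s.1, s.2)
  end.

Section Exec.
Variables (T : Type) (l : nat -> T).

Definition ev (X : nat -> seq T) (s : seq token) : seq T :=
  flatten [seq match x with inl i => [:: l i] | inr j => X j end | x <- s].

Lemma ev_cat X s1 s2 : ev X (s1 ++ s2) = ev X s1 ++ ev X s2.
Proof. by rewrite /ev map_cat flatten_cat. Qed.

Lemma rot_right_weq X Y k t b :
  weq (ev X t, ev Y b) (ev X t, ev Y (rot_right k t b)).
Proof.
case/lastP: t => [|t x]; first exact: weq_refl.
have -> : rot_right k (rcons t x) b = if x is inl i then
    let m := (index (inl i : token) b).+1 in take m b ++ rot k (drop m b) else b.
  by case: t => [|y t] //=; rewrite last_rcons.
case: x => [i|j] /=; last exact: weq_refl.
have [ib|nib] := boolP (inl i \in b); last first.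
  (* An absent letter has index [size b], so the part to be rotated is empty. *)
  rewrite drop_oversize ?take_oversize ?rot_oversize ?cats0 //;
    by rewrite ?(memNindex nib) //; apply: weq_refl.
have lt := ib; rewrite -index_mem in lt; set m := index _ _ in lt *.
have -> : ev X (rcons t (inl i)) = rcons (ev X t) (l i).
  by rewrite -!cats1 ev_cat.
set Q := drop _ _; have eb : b = take m b ++ inl i :: Q.
  by rewrite -[LHS](cat_take_drop m) (drop_nth (inl i)) // nth_index.
rewrite (take_nth (inl i)) // nth_index // {1}eb -(cat1s (inl i)) -(cats1 (take m b)).
rewrite -{1}(cat_take_drop k Q) !ev_cat -!catA /=.
exact: weq_right.
Qed.

Lemma rot_left_weq X Y k t b :
  weq (ev X t, ev Y b) (ev X t, ev Y (rot_left k t b)).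
Proof.
case: t => [|[i|j] t]; try exact: weq_refl.
rewrite /rot_left; case: ifP => ib; last exact: weq_refl.
have lt := ib; rewrite -index_mem in lt; set m := index _ _ in lt *.
rewrite (drop_nth (inl i)) // nth_index //; set Q := drop _ _.
have eb : b = take m b ++ inl i :: Q.
  by rewrite -[LHS](cat_take_drop m) (drop_nth (inl i)) // nth_index.
rewrite {1}eb -{1}(cat_take_drop k (take m b)) -(cat1s (inl i)) !ev_cat -!catA.
exact: weq_left.
Qed.

(** Proof by reflection: on concrete token words [foldl exec] computes, so an identity is checked by
    conversion. Letters have one reading [l] in both rows, factors are read by [X] above and [Y]
    below. *)
Lemma exec_weq X Y ms s :
  weq (ev X s.1, ev Y s.2)
      (ev X (foldl exec s ms).1, ev Y (foldl exec s ms).2).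
Proof.
elim: ms s => [|[c k] ms ih] s /=; first exact: weq_refl.
apply: weq_trans (ih _); case: c => [|[|[|c]]] /=.
- exact: rot_right_weq.
- exact: rot_left_weq.
- exact/weq_swap/rot_right_weq.
- exact/weq_swap/rot_left_weq.
Qed.

End Exec.

(* The move lists below come from a bidirectional search on token words; factors
   and letters being arbitrary, each of them gives an identity valid in any
   context. *)
Section Identities.
Variable T : Type.
Implicit Types (X Y Z W R N A : seq T).

Notation L := inl (only parsing).
Notation O := inr (only parsing).

Lemma weq_rot l0 l1 l2 X X' Y Y' :
  weq (l0 :: X ++ l1 :: Y ++ [:: l2], l2 :: X' ++ l1 :: Y' ++ [:: l0])
      (l1 :: Y ++ l0 :: X ++ [:: l2], l2 :: Y' ++ l0 :: X' ++ [:: l1]).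
Proof.
exact: (exec_weq (nth l0 [:: l0; l1; l2]) (nth [::] [:: X; Y])
  (nth [::] [:: X'; Y']) [:: (3, 2); (0, 2)]
  ([:: L 0; O 0; L 1; O 1; L 2], [:: L 2; O 0; L 1; O 1; L 0])).
Qed.

(** Here [l1] and [l2] are 1-blocks, [l0] and [l3] the end letters. The first two chains trade
    places, while [l3] becomes a 1-block and [l1] an end letter. *)
Lemma weq_swap_chains l0 l1 l2 l3 X X' Y Y' Z Z' :
  weq (l0 :: X ++ l1 :: Y ++ l2 :: Z ++ [:: l3],
       l3 :: X' ++ l1 :: Y' ++ l2 :: Z' ++ [:: l0])
      (l0 :: Y ++ l3 :: X ++ l2 :: Z ++ [:: l1],
       l1 :: Y' ++ l3 :: X' ++ l2 :: Z' ++ [:: l0]).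
Proof.
exact: (exec_weq (nth l0 [:: l0; l1; l2; l3])
  (nth [::] [:: X; Y; Z]) (nth [::] [:: X'; Y'; Z'])
  [:: (3, 4); (2, 2); (1, 2); (3, 2)]
  ([:: L 0; O 0; L 1; O 1; L 2; O 2; L 3],
   [:: L 3; O 0; L 1; O 1; L 2; O 2; L 0])).
Qed.

(* Once the 2-blocks of a chain have been moved into [W] one by one, the reversal
   and exchange identities apply with [W] opaque; for opaque factors in place of
   the chains [2^m] themselves they fail. *)
Lemma weq_flip_left l0 l1 l2 l3 l4 l5 W W' Z Z' :
  weq (l0 :: l1 :: W ++ l2 :: l3 :: l4 :: Z ++ [:: l5],
       l5 :: W' ++ l2 :: l1 :: l4 :: l3 :: Z' ++ [:: l0])
      (l0 :: l3 :: l5 :: l1 :: W ++ l4 :: Z ++ [:: l2],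
       l2 :: l1 :: l5 :: W' ++ l4 :: l3 :: Z' ++ [:: l0]).
Proof.
exact: (exec_weq (nth l0 [:: l0; l1; l2; l3; l4; l5])
  (nth [::] [:: W; Z]) (nth [::] [:: W'; Z'])
  [:: (3, 5); (2, 3); (1, 2); (3, 2)]
  ([:: L 0; L 1; O 0; L 2; L 3; L 4; O 1; L 5],
   [:: L 5; O 0; L 2; L 1; L 4; L 3; O 1; L 0])).
Qed.

(** Mirror version: the 2-block to the left of the configuration [l3 l4 W] above [l4 W' l3] is
    absorbed as a 2-block at the right end of [W]. *)
Lemma weq_flip_right l0 l1 l2 l3 l4 l5 Z Z' W W' :
  weq (l0 :: Z ++ l1 :: l2 :: l3 :: l4 :: W ++ [:: l5],
       l5 :: Z' ++ l2 :: l1 :: l4 :: W' ++ [:: l3; l0])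
      (l0 :: Z ++ l1 :: l4 :: W ++ [:: l2; l3; l5],
       l5 :: Z' ++ l4 :: W' ++ [:: l3; l2; l1; l0]).
Proof.
exact: (exec_weq (nth l0 [:: l0; l1; l2; l3; l4; l5])
  (nth [::] [:: Z; W]) (nth [::] [:: Z'; W'])
  [:: (1, 4); (3, 3); (1, 3); (3, 2)]
  ([:: L 0; O 0; L 1; L 2; L 3; L 4; O 1; L 5],
   [:: L 5; O 0; L 2; L 1; L 4; O 1; L 3; L 0])).
Qed.

(** [W] and [A] trade sides of the 3-block. Each comes out locked in a configuration, [l7 A l0]
    above [A' l0 l7] and [l2 l8 W] above [l8 W' l2], from which its 2-blocks are released
    afterwards. *)
Lemma weq_reverse3 l0 l1 l2 l3 l4 l5 l6 l7 l8 W W' A A' :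
  weq (l0 :: W ++ l1 :: l2 :: l3 :: l4 :: l5 :: l6 :: l7 :: A ++ [:: l8],
       l8 :: W' ++ l2 :: l1 :: l5 :: l4 :: l3 :: l7 :: l6 :: A' ++ [:: l0])
      (l6 :: l7 :: A ++ l0 :: l4 :: l5 :: l1 :: l2 :: l8 :: W ++ [:: l3],
       l3 :: A' ++ l0 :: l7 :: l1 :: l5 :: l4 :: l8 :: W' ++ [:: l2; l6]).
Proof.
exact: (exec_weq (nth l0 [:: l0; l1; l2; l3; l4; l5; l6; l7; l8])
  (nth [::] [:: W; A]) (nth [::] [:: W'; A'])
  [:: (3, 4); (1, 3); (3, 3); (1, 6); (2, 2); (0, 8)]
  ([:: L 0; O 0; L 1; L 2; L 3; L 4; L 5; L 6; L 7; O 1; L 8],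
   [:: L 8; O 0; L 2; L 1; L 5; L 4; L 3; L 7; L 6; O 1; L 0])).
Qed.

Lemma weq_reverse3_chain l0 l1 l2 l3 l4 l5 l6 l7 l8 l9 W W' A A' R R' :
  weq (l0 :: W ++ l1 :: l2 :: l3 :: l4 :: l5 :: l6 :: l7 :: A ++ l8 :: R ++
       [:: l9],
       l9 :: W' ++ l2 :: l1 :: l5 :: l4 :: l3 :: l7 :: l6 :: A' ++ l8 :: R' ++
       [:: l0])
      (l9 :: l7 :: A ++ l3 :: l4 :: l5 :: l6 :: l2 :: l0 :: W ++ l8 :: R ++
       [:: l1],
       l1 :: A' ++ l3 :: l7 :: l6 :: l5 :: l4 :: l0 :: W' ++ l2 :: l8 :: R' ++
       [:: l9]).
Proof.
exact: (exec_weq (nth l0 [:: l0; l1; l2; l3; l4; l5; l6; l7; l8; l9])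
  (nth [::] [:: W; A; R]) (nth [::] [:: W'; A'; R'])
  [:: (0, 3); (2, 5); (1, 3); (3, 5); (0, 4); (1, 8); (2, 4); (3, 2)]
  ([:: L 0; O 0; L 1; L 2; L 3; L 4; L 5; L 6; L 7; O 1; L 8; O 2; L 9],
   [:: L 9; O 0; L 2; L 1; L 5; L 4; L 3; L 7; L 6; O 1; L 8; O 2; L 0])).
Qed.

(** For a 3-block without 2-blocks to its right: the configuration [l1 W l2] above [W' l2 l1] is
    opened and the 3-block passes to its left. *)
Lemma weq_shift3 l0 l1 l2 l3 l4 l5 l6 W W' :
  weq (l0 :: l1 :: W ++ [:: l2; l3; l4; l5; l6],
       l6 :: W' ++ [:: l2; l1; l5; l4; l3; l0])
      (l2 :: l6 :: l3 :: l4 :: l0 :: l1 :: W ++ [:: l5],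
       l5 :: l4 :: l3 :: l6 :: l1 :: l0 :: W' ++ [:: l2]).
Proof.
exact: (exec_weq (nth l0 [:: l0; l1; l2; l3; l4; l5; l6])
  (nth [::] [:: W]) (nth [::] [:: W'])
  [:: (0, 2); (2, 3); (1, 2); (3, 3)]
  ([:: L 0; L 1; O 0; L 2; L 3; L 4; L 5; L 6],
   [:: L 6; O 0; L 2; L 1; L 5; L 4; L 3; L 0])).
Qed.

Lemma weq_shift3_chain l0 l1 l2 l3 l4 l5 l6 l7 W W' R R' :
  weq (l0 :: l1 :: W ++ l2 :: l3 :: l4 :: l5 :: l6 :: R ++ [:: l7],
       l7 :: W' ++ l2 :: l1 :: l5 :: l4 :: l3 :: l6 :: R' ++ [:: l0])
      (l5 :: l6 :: l3 :: l4 :: l7 :: l1 :: W ++ l2 :: R ++ [:: l0],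
       l0 :: l4 :: l3 :: l6 :: l1 :: l7 :: W' ++ l2 :: R' ++ [:: l5]).
Proof.
exact: (exec_weq (nth l0 [:: l0; l1; l2; l3; l4; l5; l6; l7])
  (nth [::] [:: W; R]) (nth [::] [:: W'; R'])
  [:: (2, 3); (0, 5); (3, 3); (1, 4); (2, 2); (0, 6)]
  ([:: L 0; L 1; O 0; L 2; L 3; L 4; L 5; L 6; O 1; L 7],
   [:: L 7; O 0; L 2; L 1; L 5; L 4; L 3; L 6; O 1; L 0])).
Qed.

Lemma weq_move4 l0 l1 l2 l3 l4 l5 l6 l7 l8 l9 l10 X X' Y Y' :
  weq (l0 :: l1 :: l2 :: l3 :: l4 :: X ++ l5 :: l6 :: l7 :: l8 :: l9 :: Y ++
       [:: l10],
       l10 :: l4 :: l3 :: l2 :: l1 :: X' ++ l5 :: l7 :: l6 :: l9 :: l8 :: Y' ++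
       [:: l0])
      (l0 :: l10 :: l4 :: l1 :: l2 :: X ++ l5 :: l6 :: l9 :: l8 :: l7 :: Y ++
       [:: l3],
       l3 :: l4 :: l10 :: l2 :: l1 :: X' ++ l5 :: l7 :: l8 :: l9 :: l6 :: Y' ++
       [:: l0]).
Proof.
exact: (exec_weq (nth l0 [:: l0; l1; l2; l3; l4; l5; l6; l7; l8; l9; l10])
  (nth [::] [:: X; Y]) (nth [::] [:: X'; Y'])
  [:: (0, 8); (2, 2); (0, 5); (2, 6); (3, 1); (0, 5); (1, 6); (3, 3); (2, 3);
      (0, 7); (2, 5); (0, 1); (2, 3); (0, 10)]
  ([:: L 0; L 1; L 2; L 3; L 4; O 0; L 5; L 6; L 7; L 8; L 9; O 1; L 10],
   [:: L 10; L 4; L 3; L 2; L 1; O 0; L 5; L 7; L 6; L 9; L 8; O 1; L 0])).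
Qed.

(** The opaque [N] stays between the two 3-blocks while [W] and [A] trade places, again locked in
    configurations. *)
Lemma weq_exchange33 l0 l1 l2 l3 l4 l5 l6 l7 l8 l9 l10 l11 W W' N N' A A' :
  weq (l0 :: W ++ l1 :: l2 :: l3 :: l4 :: l5 :: N ++ l6 :: l7 :: l8 :: l9 ::
       l10 :: A ++ [:: l11],
       l11 :: W' ++ l2 :: l1 :: l5 :: l4 :: l3 :: N' ++ l8 :: l7 :: l6 :: l10 ::
       l9 :: A' ++ [:: l0])
      (l1 :: l10 :: A ++ l0 :: l3 :: l4 :: l5 :: N ++ l6 :: l7 :: l8 :: l2 ::
       l11 :: W ++ [:: l9],
       l9 :: A' ++ l0 :: l10 :: l5 :: l4 :: l3 :: N' ++ l8 :: l7 :: l6 :: l11 ::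
       W' ++ [:: l2; l1]).
Proof.
exact: (exec_weq (nth l0 [:: l0; l1; l2; l3; l4; l5; l6; l7; l8; l9; l10; l11])
  (nth [::] [:: W; N; A]) (nth [::] [:: W'; N'; A'])
  [:: (3, 9); (1, 4); (3, 2); (2, 10); (1, 2); (3, 4); (0, 3); (2, 2); (0, 4);
      (1, 5); (2, 2); (3, 2)]
  ([:: L 0; O 0; L 1; L 2; L 3; L 4; L 5; O 1; L 6; L 7; L 8; L 9; L 10; O 2; L 11],
   [:: L 11; O 0; L 2; L 1; L 5; L 4; L 3; O 1; L 8; L 7; L 6; L 10; L 9; O 2; L 0])).
Qed.

Lemma weq_shift33 l0 l1 l2 l3 l4 l5 l6 l7 l8 l9 W W' N N' :
  weq (l0 :: l1 :: W ++ l2 :: l3 :: l4 :: l5 :: N ++ [:: l6; l7; l8; l9],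
       l9 :: W' ++ l2 :: l1 :: l5 :: l4 :: l3 :: N' ++ [:: l8; l7; l6; l0])
      (l2 :: l3 :: l4 :: l5 :: N ++ l6 :: l7 :: l9 :: l0 :: l1 :: W ++ [:: l8],
       l8 :: l5 :: l4 :: l3 :: N' ++ l9 :: l7 :: l6 :: l1 :: l0 :: W' ++
       [:: l2]).
Proof.
exact: (exec_weq (nth l0 [:: l0; l1; l2; l3; l4; l5; l6; l7; l8; l9])
  (nth [::] [:: W; N]) (nth [::] [:: W'; N'])
  [:: (0, 5); (2, 3); (0, 3); (1, 7); (3, 6); (1, 3); (3, 2); (1, 2); (2, 2); (3, 4)]
  ([:: L 0; L 1; O 0; L 2; L 3; L 4; L 5; O 1; L 6; L 7; L 8; L 9],
   [:: L 9; O 0; L 2; L 1; L 5; L 4; L 3; O 1; L 8; L 7; L 6; L 0])).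
Qed.

End Identities.
(** * Words of block sizes *)

(** On a block [p_0 + p_1] is constant, so the bottom row spells each block of the top row
    backwards. *)
Definition brev (T : Type) (s : seq nat) (t : seq T) : seq T :=
  flatten [seq rev b | b <- reshape s t].

Section Brev.
Variable T : Type.
Implicit Types (s : seq nat) (t u : seq T).

Lemma brev_cons k s t : brev (k :: s) t = rev (take k t) ++ brev s (drop k t).
Proof. by []. Qed.

Lemma brev_cat s1 s2 t1 t2 : size t1 = sumn s1 ->
  brev (s1 ++ s2) (t1 ++ t2) = brev s1 t1 ++ brev s2 t2.
Proof.
elim: s1 t1 => [|k s1 ih] t1 /=; first by move/size0nil->.
move=> e; rewrite !brev_cons take_cat drop_cat -catA.
case: ltnP => h; first by rewrite ih // size_drop; lia.
have -> : k - size t1 = 0 by lia.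
have hs : size (drop k t1) = sumn s1 by rewrite size_drop; lia.
by rewrite take0 drop0 cats0 -ih // drop_oversize ?take_oversize //; lia.
Qed.

Lemma brev1 x t s : brev (1 :: s) (x :: t) = x :: brev s t.
Proof. by rewrite brev_cons /= take0 drop0. Qed.

Lemma brev2 x y t s : brev (2 :: s) [:: x, y & t] = [:: y, x & brev s t].
Proof. by rewrite brev_cons /= take0 drop0. Qed.

Lemma brev3 x y z t s :
  brev (3 :: s) [:: x, y, z & t] = [:: z, y, x & brev s t].
Proof. by rewrite brev_cons /= take0 drop0. Qed.

Lemma brev4 x y z w t s :
  brev (4 :: s) [:: x, y, z, w & t] = [:: w, z, y, x & brev s t].
Proof. by rewrite brev_cons /= take0 drop0. Qed.

Lemma map_brev (T' : Type) (f : T -> T') s t :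
  map f (brev s t) = brev s (map f t).
Proof.
elim: s t => [|k s ih] t //.
by rewrite !brev_cons map_cat map_rev map_take ih map_drop.
Qed.

Lemma split_word (t : seq T) m k : size t = m + k ->
  exists u v, [/\ t = u ++ v, size u = m & size v = k].
Proof.
move=> e; exists (take m t), (drop m t).
by rewrite cat_take_drop size_drop e addKn size_takel // e leq_addr.
Qed.

Lemma split_head (t : seq T) k : size t = k.+1 ->
  exists x v, t = x :: v /\ size v = k.
Proof. by case: t => [|x v] //= [e]; exists x, v. Qed.

Lemma split_last (t : seq T) k : size t = k.+1 ->
  exists v x, t = v ++ [:: x] /\ size v = k.
Proof.
case/lastP: t => [|v x] //; rewrite size_rcons => -[e].
by exists v, x; rewrite cats1.
Qed.

End Brev.

(** * Standard words of a composition, up to relabeling *)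

Section Compositions.
Variable A : finType.
Implicit Types (s : seq nat) (t u : seq A).

Definition full t := uniq t && (size t == #|A|).

Lemma full_mem t x : full t -> x \in t.
Proof.
case/andP=> ut /eqP st; have ct : #|t| = #|A| by rewrite (card_uniqP ut).
by have /(_ (subset_predT _)) -> := elimT (subset_cardP ct).
Qed.

Inductive std s : seq A * seq A -> Prop :=
  Std a u z of size u = sumn s & full (a :: u ++ [:: z]) :
    std s (a :: u ++ [:: z], z :: brev s u ++ [:: a]).

Lemma std_ex s : (sumn s).+2 = #|A| -> exists w, std s w.
Proof.
move=> e; have : size (enum A) = (sumn s).+2 by rewrite -cardE.
case/split_head=> a [v [ev /split_last [u [z [eu su]]]]].
exists (a :: u ++ [:: z], z :: brev s u ++ [:: a]); split=> //.
by rewrite -eu -ev /full enum_uniq -cardE /=.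
Qed.

Lemma full_map (f : A -> A) t : injective f -> full t -> full (map f t).
Proof. by move=> fi; rewrite /full map_inj_uniq // size_map. Qed.

Lemma std_map (f : A -> A) s w : injective f -> std s w -> std s (map2w f w).
Proof.
move=> fi [a u z su fu]; rewrite /map2w /= !map_cat /= map_brev.
split; first by rewrite size_map.
by have := full_map fi fu; rewrite /= map_cat.
Qed.

Lemma full_relabel t t' : full t -> full t' ->
  exists2 f : A -> A, injective f & t' = map f t.
Proof.
move=> ft ft'; have /andP [ut /eqP st] := ft; have /andP [ut' /eqP st'] := ft'.
case: t' => [|x0 t'] in ft' ut' st' *.
  by move: st; rewrite -st' => /size0nil ->; exists id.
exists (fun x => nth x0 (x0 :: t') (index x t)).
  move=> x y /eqP; rewrite nth_uniq ?st' -?st ?index_mem ?full_mem //.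
  by move/eqP/(congr1 (nth x0 t)); rewrite !nth_index ?full_mem.
apply: (@eq_from_nth _ x0) => [|i hi]; first by rewrite size_map st' st.
by rewrite (nth_map x0) ?index_uniq // st -st'.
Qed.

(** The top rows fix the relabeling; the bottom row of a standard word is computed from its top row
    and follows along. *)
Lemma std_relabel s w w' : std s w -> std s w' ->
  exists2 f : A -> A, injective f & w' = map2w f w.
Proof.
case=> a u z su fu [a' u' z' su' fu'].
have [f fi e] := full_relabel fu fu'; exists f => //.
move: e; rewrite /map2w /= !map_cat /= map_brev => -[-> e].
have su2 : size u' = size (map f u) by rewrite size_map su.
move/eqP: e; rewrite eqseq_cat // => /andP [/eqP -> /eqP [->]].
by [].
Qed.

(* Equivalence of compositions: words of [s] and of [s'] are equivalent up to a
   relabeling of the letters. *)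
Definition ceq s s' := sumn s = sumn s' /\
  ((sumn s).+2 = #|A| -> exists w w', [/\ std s w, std s' w' & weq w w']).

Lemma ceq_refl s : ceq s s.
Proof.
by split=> // /std_ex [w sw]; exists w, w; split=> //; apply: weq_refl.
Qed.

Lemma ceq_sym s s' : ceq s s' -> ceq s' s.
Proof.
case=> e h; split=> // e'; case: h; first by rewrite e.
by move=> w [w' [? ? ?]]; exists w', w; split=> //; apply: weq_sym.
Qed.

Lemma ceq_trans s2 s1 s3 : ceq s1 s2 -> ceq s2 s3 -> ceq s1 s3.
Proof.
case=> e1 h1 [e2 h2]; split=> [|en]; first by rewrite e1.
have [w1 [w2 [sw1 sw2 q]]] := h1 en.
have [|v2 [v3 [sv2 sv3 q']]] := h2; first by rewrite -e1.
(* The two words of [s2] may carry different letters; a relabeling glues the equivalences. *)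
have [f fi e] := std_relabel sv2 sw2.
exists w1, (map2w f v3); split=> //; first exact: std_map.
by apply: weq_trans q _; rewrite e; apply: weq_map.
Qed.

(** Reduces an equivalence to an identity in arbitrary letters. The endpoint is a standard word
    because [weq] permutes each row. *)
Lemma ceqP s s' : sumn s = sumn s' ->
  (forall a u z, size u = sumn s -> exists a' u' z',
     weq (a :: u ++ [:: z], z :: brev s u ++ [:: a])
         (a' :: u' ++ [:: z'], z' :: brev s' u' ++ [:: a'])) ->
  ceq s s'.
Proof.
move=> e h; split=> // en; have [w sw] := std_ex en.
exists w; case: sw => a u z su fu; have [a' [u' [z' q]]] := h a u z su.
have /= [pq _] := weq_perm q.
exists (a' :: u' ++ [:: z'], z' :: brev s' u' ++ [:: a']); split=> //; split.
  by move/perm_size: pq; rewrite /= !size_cat su e /= => -[]; lia.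
by move: fu; rewrite /full (perm_uniq pq) (perm_size pq).
Qed.

Lemma ceq_rot s1 s2 : ceq (s1 ++ 1 :: s2) (s2 ++ 1 :: s1).
Proof.
apply: ceqP => [|a u z]; first by rewrite !sumn_cat /=; lia.
rewrite sumn_cat => /split_word [X [v [-> sX]]] /split_head [b [Y [-> sY]]].
exists b, (Y ++ a :: X), z; rewrite !brev_cat // !brev1 -!catA /=.
exact: weq_rot.
Qed.

Lemma ceq_swap s1 s2 s3 :
  ceq (s1 ++ 1 :: s2 ++ 1 :: s3) (s2 ++ 1 :: s1 ++ 1 :: s3).
Proof.
apply: ceqP => [|a u z]; first by rewrite !sumn_cat /= !sumn_cat /=; lia.
rewrite sumn_cat /= sumn_cat => /split_word [X [v [-> sX]]].
case/split_head=> b [v' [-> ]] /split_word [Y [v2 [-> sY]]].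
case/split_head=> c [Z [-> sZ]].
(* The end letters and the 1-blocks are left open; unification with the identity finds them. *)
eexists _, (Y ++ _ :: X ++ _ :: Z), _.
rewrite !(brev_cat, brev1) // -!catA /= -!catA /=; exact: weq_swap_chains.
Qed.

Lemma ceq_move4 s1 s2 :
  ceq (4 :: s1 ++ [:: 1, 2, 2 & s2]) [:: 2, 2 & s1 ++ [:: 1, 4 & s2]].
Proof.
apply: ceqP => [|a u z]; first by rewrite /= !sumn_cat /=; lia.
rewrite /= sumn_cat => /split_head [l1 [v [->]]] /split_head [l2 [v1 [->]]].
case/split_head=> l3 [v2 [->]] /split_head [l4 [v3 [->]]] /split_word [X [v4 [-> sX]]].
case/split_head=> l5 [v5 [->]] /split_head [l6 [v6 [->]]].
case/split_head=> l7 [v7 [->]] /split_head [l8 [v8 [->]]].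
case/split_head=> l9 [Y [-> sY]].
eexists _, [:: _, _, _, _ & X ++ [:: _, _, _, _, _ & Y]], _.
rewrite brev4 !brev2 !brev_cat // !brev1 !brev4 !brev2 /= -!catA /=.
exact: weq_move4.
Qed.

End Compositions.
(** * Chains with a 3-block *)

Lemma nseqSr (T : Type) m (x : T) : nseq m.+1 x = nseq m x ++ [:: x].
Proof. by rewrite -addn1 nseqD. Qed.

Lemma sumn_cons x s : sumn (x :: s) = x + sumn s. Proof. by []. Qed.

Definition catE := (@cat_cons, @cat0s, fun T (x y z : seq T) => esym (catA x y z)).

Notation twos m := (nseq m 2).

Section Flips.
Variable T : Type.
Implicit Types U V Z : seq T.

Lemma split_twos V m : size V = sumn (twos m.+1) ->
  exists p q V', [/\ V = [:: p, q & V'], size V' = sumn (twos m)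
                   & brev (twos m.+1) V = [:: q, p & brev (twos m) V']].
Proof.
move=> /split_head [p [v [->]]] /split_head [q [V' [-> sV]]].
by exists p, q, V'; rewrite brev2.
Qed.

Lemma split_twosr V m : size V = sumn (twos m.+1) ->
  exists V' p q, [/\ V = V' ++ [:: p; q], size V' = sumn (twos m)
                   & brev (twos m.+1) V = brev (twos m) V' ++ [:: q; p]].
Proof.
rewrite nseqSr sumn_cat => /split_word [V' [v [-> sV]]].
case/split_head=> p [v' [->]] /split_head [q [v2 [-> /size0nil ->]]].
by exists V', p, q; rewrite brev_cat // brev2.
Qed.

(** For empty [V] the letters [x] and [y] form a 2-block. Each flip moves the first 2-block of [U]
    to the front of [V]; [k] counts the blocks already absorbed and makes the induction possible. *)
Lemma weq_flips_left k m a x y z V U Z Z' :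
  size V = sumn (twos k) -> size U = sumn (twos m) ->
  exists a' x' y' z' V', size V' = sumn (twos (k + m)) /\
  weq (a :: x :: V ++ y :: U ++ Z ++ [:: z],
       z :: brev (twos k) V ++ y :: x :: brev (twos m) U ++ Z' ++ [:: a])
      (a' :: x' :: V' ++ y' :: Z ++ [:: z'],
       z' :: brev (twos (k + m)) V' ++ y' :: x' :: Z' ++ [:: a']).
Proof.
elim: m k a x y z V U => [|m ih] k a x y z V U sV.
  move/size0nil=> ->; exists a, x, y, z, V; rewrite addn0; split=> //.
  exact: weq_refl.
case/split_twos=> p [q [U' [-> sU ->]]].
have sV' : size [:: z, x & V] = sumn (twos k.+1) by rewrite /= sV.
have [a' [x' [y' [z' [V' [sV2 h]]]]]] := ih k.+1 a p q y _ U' sV' sU.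
exists a', x', y', z', V'; rewrite addnS -addSn; split=> //.
apply: weq_trans h; rewrite brev2.
have := weq_flip_left a x y p q z V (brev (twos k) V) (U' ++ Z)
  (brev (twos m) U' ++ Z').
by rewrite -!catA.
Qed.

(** The release of locked 2-blocks: inverse flips expel them from [V] one by one to the right, each
    joining [Z] for the induction. *)
Lemma weq_unflips_left m a x y z V Z Z' : size V = sumn (twos m) ->
  exists a' x' y' z' U, size U = sumn (twos m) /\
  weq (a :: x :: V ++ y :: Z ++ [:: z],
       z :: brev (twos m) V ++ y :: x :: Z' ++ [:: a])
      (a' :: x' :: y' :: U ++ Z ++ [:: z'],
       z' :: y' :: x' :: brev (twos m) U ++ Z' ++ [:: a']).
Proof.
elim: m a x y z V Z Z' => [|m ih] a x y z V Z Z'.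
  move/size0nil=> ->; exists a, x, y, z, [::]; split=> //; exact: weq_refl.
case/split_twos=> p [q [V' [-> sV ->]]].
have [a' [x' [y' [z' [U [sU h]]]]]] := ih a q z p V' (x :: y :: Z) (y :: x :: Z') sV.
exists a', x', y', z', (U ++ [:: x; y]); split.
  by rewrite nseqSr sumn_cat size_cat sU.
rewrite nseqSr brev_cat // brev2 -!catA.
by apply: weq_trans (weq_sym (weq_flip_left a q z x y p _ _ _ _)) h.
Qed.

Lemma weq_unflips_right m a x y z V Z Z' : size V = sumn (twos m) ->
  exists a' x' y' z' U, size U = sumn (twos m) /\
  weq (a :: Z ++ x :: y :: V ++ [:: z],
       z :: Z' ++ y :: brev (twos m) V ++ [:: x; a])
      (a' :: Z ++ U ++ [:: x'; y'; z'],
       z' :: Z' ++ brev (twos m) U ++ [:: y'; x'; a']).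
Proof.
elim: m a x y z V Z Z' => [|m ih] a x y z V Z Z'.
  move/size0nil=> ->; exists a, x, y, z, [::]; split=> //; exact: weq_refl.
case/split_twosr=> V' [p [q [-> sV ->]]].
have [a' [x' [y' [z' [U [sU h]]]]]] :=
  ih a q y z V' (Z ++ [:: x; p]) (Z' ++ [:: p; x]) sV.
exists a', x', y', z', [:: x, p & U]; split; first by rewrite /= sU.
rewrite brev2; move: h; rewrite -!catA /=; apply: weq_trans.
exact: (weq_sym (weq_flip_right a x p q y z Z Z' V' (brev (twos m) V'))).
Qed.

End Flips.

Definition c3 m l := twos m ++ 3 :: twos l.

Section Chain3.
Variable A : finType.

Let split3 (t : seq A) k : size t = 3 + k ->
  exists x y z v, t = [:: x, y, z & v] /\ size v = k.
Proof.
case/split_head=> x [v [-> /split_head [y [v' [-> /split_head [z [w [-> e]]]]]]]].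
by exists x, y, z, w.
Qed.

(** Treated apart because [weq_reverse3] needs a 2-block on both sides of the 3-block. The first
    2-block absorbs the others, then the 3-block is shifted over the configuration. *)
Lemma ceq_reverse0 m : ceq A (c3 m 0) (c3 0 m).
Proof.
case: m => [|m]; first exact: ceq_refl.
apply: ceqP => [|a u z]; first by rewrite /c3 sumn_cat /= addnC.
rewrite /c3 sumn_cat => /split_word [U0 [v [-> sU0]]].
case/split3=> c [d [e [v' [-> /size0nil ->]]]]; rewrite brev_cat // brev3.
have [x [y [U [-> sU ->]]]] := split_twos sU0.
have [a1 [x1 [y1 [z1 [V [sV h]]]]]] :=
  @weq_flips_left _ 0 m a x y z [::] U [:: c; d; e] [:: e; d; c] erefl sU.
eexists _, [:: _, _, _, _, _ & V], _; rewrite brev3 brev2 /= -!catA.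
exact: (weq_trans h (weq_shift3 a1 x1 y1 c d e z1 V (brev (twos m) V))).
Qed.

Lemma ceq_reverse m l : ceq A (c3 m l) (c3 l m).
Proof.
case: l => [|l]; first exact: ceq_reverse0.
case: m => [|m]; first exact/ceq_sym/ceq_reverse0.
apply: ceqP => [|a u z].
  by rewrite /c3 !sumn_cat /=; lia.
rewrite /c3 sumn_cat => /split_word [U0 [v [-> sU]]].
case/split3=> c [d [e [V0 [-> sV]]]]; rewrite brev_cat // brev3.
have [W [x [y [-> sW ->]]]] := split_twosr sU.
have [p [q [B [-> sB ->]]]] := split_twos sV.
(* [h1] makes [W] and [B] trade sides; [h2] and [h3] release the 2-blocks of [B] and of [W]. *)
have h1 := weq_reverse3 a x y c d e p q z W (brev (twos m) W) B (brev (twos l) B).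
have [a1 [x1 [y1 [z1 [V [sV1 h2]]]]]] := weq_unflips_left p q a c
  ([:: d; e; x; y; z] ++ W) ([:: x; e; d; z] ++ brev (twos m) W ++ [:: y]) sB.
have [a2 [x2 [y2 [z2 [V2 [sV2 h3]]]]]] := weq_unflips_right a1 y z z1
  ([:: x1; y1] ++ V ++ [:: d; e; x]) ([:: y1; x1] ++ brev (twos l) V ++ [:: x; e; d]) sW.
exists a2, ([:: x1; y1] ++ V ++ [:: d; e; x] ++ V2 ++ [:: x2; y2]), z2.
have -> : brev (twos l.+1 ++ 3 :: twos m.+1)
    ([:: x1; y1] ++ V ++ [:: d; e; x] ++ V2 ++ [:: x2; y2]) =
    [:: y1; x1] ++ brev (twos l) V ++ [:: x; e; d] ++ brev (twos m) V2 ++ [:: y2; x2].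
  rewrite /= brev2 brev_cat // brev3 -[2 :: twos m]/(twos m.+1) nseqSr.
  by rewrite brev_cat // brev2.
rewrite -!catA /= in h1 h2 h3 *.
apply: weq_trans h1 _; apply: weq_trans h2 _; exact: h3.
Qed.

Lemma ceq_reverse0_chain m s : ceq A (c3 m 0 ++ 1 :: s) (c3 0 m ++ 1 :: s).
Proof.
case: m => [|m]; first exact: ceq_refl.
apply: ceqP => [|a u z]; first by rewrite /c3 !sumn_cat /=; lia.
rewrite /c3 -catA sumn_cat => /split_word [U0 [v [-> sU0]]].
case/split3=> c [d [e [v' [-> ]]]] /split_head [f [R [-> sR]]].
rewrite brev_cat // brev3 brev1.
have [x [y [U [-> sU ->]]]] := split_twos sU0.
have [a1 [x1 [y1 [z1 [V [sV h]]]]]] := @weq_flips_left _ 0 m a x y z [::] U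
  [:: c, d, e, f & R] [:: e, d, c, f & brev s R] erefl sU.
eexists _, [:: _, _, _, _, _ & V ++ _ :: R], _.
rewrite brev3 brev2 brev_cat // brev1 !(cat_cons, =^~ catA).
exact: (weq_trans h (weq_shift3_chain a1 x1 y1 c d e f z1 V (brev (twos m) V)
  R (brev s R))).
Qed.

Lemma ceq_reverse_chain m l s : ceq A (c3 m l ++ 1 :: s) (c3 l m ++ 1 :: s).
Proof.
case: l => [|l]; first exact: ceq_reverse0_chain.
case: m => [|m]; first exact/ceq_sym/ceq_reverse0_chain.
(* The release on the right needs its configuration at the end of the word, so the target is rotated
   to have [s] in front; [h3] below performs the matching rotation. *)
apply: (ceq_trans _ (ceq_rot A s _)).
apply: ceqP => [|a u z]; first by rewrite /c3 !sumn_cat /= !sumn_cat /=; lia.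
rewrite /c3 -catA; move eL : (twos l.+1) => L.
rewrite !(sumn_cat, sumn_cons 3) => /split_word [U0 [v [-> sU]]].
case/split3=> c [d [e [v' [->]]]] /split_word [V0 [v2 [-> sV]]].
case/split_head=> f [R [-> sR]].
rewrite brev_cat // brev3 brev_cat // brev1; rewrite -{}eL in sV *.
have [W [x [y [-> sW ->]]]] := split_twosr sU.
have [p [q [B [-> sB ->]]]] := split_twos sV.
have h1 := weq_reverse3_chain a x y c d e p q f z W (brev (twos m) W)
  B (brev (twos l) B) R (brev s R).
have [a1 [x1 [y1 [z1 [V [sV1 h2]]]]]] := weq_unflips_left z q c x
  ([:: d; e; p; y; a] ++ W ++ f :: R)
  ([:: p; e; d; a] ++ brev (twos m) W ++ [:: y, f & brev s R]) sB.
have h3 := weq_rot a1 f z1 ([:: x1; y1] ++ V ++ [:: d; e; p; y; a] ++ W)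
  ([:: y1; x1] ++ brev (twos l) V ++ [:: p; e; d; a] ++ brev (twos m) W ++ [:: y])
  R (brev s R).
have [a2 [x2 [y2 [z2 [V2 [sV2 h4]]]]]] := weq_unflips_right f y a z1
  (R ++ [:: a1; x1; y1] ++ V ++ [:: d; e; p])
  (brev s R ++ [:: a1; y1; x1] ++ brev (twos l) V ++ [:: p; e; d]) sW.
exists a2, (R ++ [:: a1; x1; y1] ++ V ++ [:: d; e; p] ++ V2 ++ [:: x2; y2]), z2.
rewrite brev_cat // brev1 brev2 brev_cat // brev3.
rewrite nseqSr brev_cat // brev2 !catE.
rewrite !catE in h1 h2 h3 h4.
apply: weq_trans h1 _; apply: weq_trans h2 _; apply: weq_trans h3 _; exact: h4.
Qed.

Lemma ceq_exchange0 m s :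
  ceq A (twos m ++ 3 :: s ++ [:: 3]) ([:: 3 & s] ++ 3 :: twos m).
Proof.
case: m => [|m]; first exact: ceq_refl.
apply: ceqP => [|a u z]; first by rewrite /= !sumn_cat /= !sumn_cat /=; lia.
rewrite !(sumn_cat, sumn_cons 3) => /split_word [U0 [v [-> sU0]]].
case/split3=> c [d [e [v' [-> ]]]] /split_word [N [v2 [-> sN]]].
case/split3=> f [g [h [v3 [-> /size0nil ->]]]].
rewrite brev_cat // brev3 brev_cat // brev3.
have [x [y [U [-> sU ->]]]] := split_twos sU0.
have [a1 [x1 [y1 [z1 [V [sV h1]]]]]] := @weq_flips_left _ 0 m a x y z [::] U
  ([:: c; d; e] ++ N ++ [:: f; g; h])
  ([:: e; d; c] ++ brev s N ++ [:: h; g; f]) erefl sU.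
exists y1, [:: c, d, e & N ++ [:: f, g, z1, a1, x1 & V]], h.
rewrite brev3 brev_cat // brev3 brev2 -!catA.
have h2 := weq_shift33 a1 x1 y1 c d e f g h z1 V (brev (twos m) V) N (brev s N).
rewrite !catE in h1 h2 |- *; exact: weq_trans h1 h2.
Qed.

(** Since [s] is arbitrary and may contain 1-blocks, the two exponents may belong to different
    chains. *)
Lemma ceq_exchange m l s : ceq A (twos m ++ 3 :: s ++ 3 :: twos l)
                                 (twos l ++ 3 :: s ++ 3 :: twos m).
Proof.
case: l => [|l]; first exact: ceq_exchange0.
case: m => [|m]; first exact/ceq_sym/ceq_exchange0.
apply: ceqP => [|a u z]; first by rewrite !(sumn_cat, sumn_cons 3); lia.
rewrite !(sumn_cat, sumn_cons 3) => /split_word [U0 [v [-> sU]]].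
case/split3=> c [d [e [v' [->]]]] /split_word [N [v2 [-> sN]]].
case/split3=> f [g [h [V0 [-> sV]]]].
rewrite brev_cat // brev3 brev_cat // brev3.
have [W [x [y [-> sW ->]]]] := split_twosr sU.
have [p [q [B [-> sB ->]]]] := split_twos sV.
have h1 := weq_exchange33 a x y c d e f g h p q z W (brev (twos m) W)
  N (brev s N) B (brev (twos l) B).
have [a1 [x1 [y1 [z1 [V [sV1 h2]]]]]] := weq_unflips_left x q a p
  ([:: c; d; e] ++ N ++ [:: f; g; h; y; z] ++ W)
  ([:: e; d; c] ++ brev s N ++ [:: h; g; f; z] ++ brev (twos m) W ++ [:: y]) sB.
have [a2 [x2 [y2 [z2 [V2 [sV2 h3]]]]]] := weq_unflips_right a1 y z z1
  ([:: x1; y1] ++ V ++ [:: c; d; e] ++ N ++ [:: f; g; h])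
  ([:: y1; x1] ++ brev (twos l) V ++ [:: e; d; c] ++ brev s N ++ [:: h; g; f]) sW.
exists a2, ([:: x1; y1] ++ V ++ [:: c; d; e] ++ N ++ [:: f; g; h] ++ V2 ++
  [:: x2; y2]), z2.
rewrite brev2 brev_cat // brev3 brev_cat // brev3.
rewrite nseqSr brev_cat // brev2 !catE.
rewrite !catE in h1 h2 h3.
apply: weq_trans h1 _; apply: weq_trans h2 _; exact: h3.
Qed.

End Chain3.
(** * Rearranging chains *)

(** Adjacent transpositions generate all permutations: [move] carries one element past a list, and
    the prefix [p] provides the context for the induction. *)
Lemma perm_transp_ind (T : eqType) (R : seq T -> seq T -> Prop) :
  (forall s, R s s) -> (forall s2 s1 s3, R s1 s2 -> R s2 s3 -> R s1 s3) ->
  (forall l1 x y l2, R (l1 ++ [:: x, y & l2]) (l1 ++ [:: y, x & l2])) ->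
  forall s s', perm_eq s s' -> R s s'.
Proof.
move=> Rxx Rtr Rsw.
have move x l1 : forall p l2, R (p ++ x :: l1 ++ l2) (p ++ l1 ++ x :: l2).
  elim: l1 => [|y l1 ih] p l2 /=; first exact: Rxx.
  by apply: Rtr (Rsw _ _ _ _) _; have := ih (rcons p y) l2; rewrite !cat_rcons.
suff H s : forall p s', perm_eq s s' -> R (p ++ s) (p ++ s').
  by move=> s s'; apply: (H s [::]).
elim: s => [|x s ih] p s'.
  by rewrite perm_sym => /perm_nilP ->; apply: Rxx.
move=> ps; have xs : x \in s' by rewrite -(perm_mem ps) mem_head.
case/splitPr: xs ps => l1 l2.
rewrite perm_sym -(cat1s x l2) perm_catCA perm_cons perm_sym.
by move/(ih (rcons p x)); rewrite !cat_rcons => h; apply: Rtr h (move _ _ _ _).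
Qed.

Fixpoint join (cs : seq (seq nat)) : seq nat :=
  if cs is c :: cs' then if cs' is [::] then c else c ++ 1 :: join cs'
  else [::].

Lemma join_cons c cs : cs != [::] -> join (c :: cs) = c ++ 1 :: join cs.
Proof. by case: cs. Qed.

Lemma join_cat cs1 cs2 : cs1 != [::] -> cs2 != [::] ->
  join (cs1 ++ cs2) = join cs1 ++ 1 :: join cs2.
Proof.
elim: cs1 => // c cs1 ih _ n2; case: cs1 => [|c' cs1] in ih *.
  by rewrite /= -/join; case: cs2 n2 {ih}.
by rewrite cat_cons join_cons // ih // [in RHS]join_cons // -catA.
Qed.

Lemma join_rcons cs c d : join (rcons cs (c ++ d)) = join (rcons cs c) ++ d.
Proof.
case: cs => [|c' cs]; first by [].
by rewrite -!cats1 !join_cat // -catA.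
Qed.

Section Rearrange.
Variable A : finType.
Local Notation ceq := (ceq A).

Lemma ceq_join_rot cs1 cs2 : ceq (join (cs1 ++ cs2)) (join (cs2 ++ cs1)).
Proof.
case: cs1 => [|c1 cs1]; first by rewrite cats0; apply: ceq_refl.
case: cs2 => [|c2 cs2]; first by rewrite cats0; apply: ceq_refl.
by rewrite !join_cat //; apply: ceq_rot.
Qed.

(** A rotation brings two adjacent chains to the front, where they are exchanged by [ceq_swap], or
    by [ceq_rot] when they are the only ones. *)
Lemma ceq_join_perm cs cs' : perm_eq cs cs' -> ceq (join cs) (join cs').
Proof.
apply: (perm_transp_ind (R := fun cs cs' => ceq (join cs) (join cs'))).
- by move=> s; apply: ceq_refl.
- by move=> s2 s1 s3; apply: ceq_trans.
move=> l1 x y l2; apply: (ceq_trans (ceq_join_rot _ _)).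
apply: (ceq_trans _ (ceq_join_rot _ _)) => /=.
case: (l2 ++ l1) => [|c r]; first exact: ceq_rot.
exact: ceq_swap.
Qed.

Lemma ceq_join_reverse m l cs :
  ceq (join (c3 m l :: cs)) (join (c3 l m :: cs)).
Proof.
case: cs => [|c cs]; first exact: ceq_reverse.
exact: ceq_reverse_chain.
Qed.

(** With one chain moved to the end and the other in front, [y] and [x] are the outer exponents of
    the whole word, and [ceq_exchange] applies with everything between the two 3-blocks as its
    [s]. *)
Lemma ceq_join_exchange m x y w cs :
  ceq (join [:: c3 m x, c3 y w & cs]) (join [:: c3 m y, c3 x w & cs]).
Proof.
have e x' y' : perm_eq [:: c3 m x', c3 y' w & cs]
                       (c3 y' w :: rcons cs (c3 m x')).
  by rewrite perm_sym -rcons_cons perm_rcons.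
apply: ceq_trans (ceq_join_perm (e _ _)) _; apply: ceq_sym.
apply: ceq_trans (ceq_join_perm (e _ _)) _.
rewrite !join_cons; try by case: (cs).
have := ceq_exchange A x y (twos w ++ 1 :: join (rcons cs (twos m))).
by rewrite /c3 !join_rcons !catE.
Qed.

Lemma ceq_join_move4 m l cs :
  ceq (join [:: 4 :: twos m, twos l.+2 & cs])
      (join [:: twos m.+2, 4 :: twos l & cs]).
Proof.
case: cs => [|c cs]; first exact: (ceq_move4 A (twos m) (twos l)).
rewrite ![join [:: _, _, _ & _]]join_cons // ![join [:: _, _ & _]]join_cons //.
exact: (ceq_move4 A (twos m) (twos l ++ 1 :: join (c :: cs))).
Qed.

(* The chains [2^m 3 2^l] encoded by the flat list of their exponents, so that
   their rearrangements are permutations of a list of numbers. *)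
Fixpoint c3s (e : seq nat) : seq (seq nat) :=
  if e is m :: e' then if e' is l :: e'' then c3 m l :: c3s e'' else [::]
  else [::].

Lemma c3s_cat e1 e2 : ~~ odd (size e1) -> c3s (e1 ++ e2) = c3s e1 ++ c3s e2.
Proof.
have [n] := ubnP (size e1); elim: n e1 => // n ih [|x [|y e1]] //=.
by rewrite negbK => lt od; rewrite ih //; lia.
Qed.

(** A transposition of adjacent exponents either reverses one chain or exchanges exponents of two
    consecutive chains, according to the parity of its place. *)
Lemma ceq_join_c3s e e' cs : perm_eq e e' -> ~~ odd (size e) ->
  ceq (join (c3s e ++ cs)) (join (c3s e' ++ cs)).
Proof.
(* Equality of sizes is added to the relation so that the parity passes through transitivity. *)
move=> pe; have se := perm_size pe; have: size e = size e' /\ (~~ odd (size e) ->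
  ceq (join (c3s e ++ cs)) (join (c3s e' ++ cs))); last by case.
move: e e' pe {se}; apply: perm_transp_ind.
- by move=> s; split=> // _; apply: ceq_refl.
- move=> s2 s1 s3 [e1 h1] [e2 h2]; split=> [|od]; first by rewrite e1.
  by apply: ceq_trans (h1 od) (h2 _); rewrite -e1.
move=> l1 x y l2; split; first by rewrite !size_cat.
have front c c' ds es :
  ceq (join (c ++ ds ++ es)) (join (c' ++ ds ++ es)) ->
  ceq (join (ds ++ c ++ es)) (join (ds ++ c' ++ es)).
  move=> h; have p : perm_eq (ds ++ c ++ es) (c ++ ds ++ es).
    by rewrite perm_catCA.
  apply: ceq_trans (ceq_join_perm p) _; apply: ceq_trans h _.
  by apply: ceq_join_perm; rewrite perm_catCA.
have [od|ev] := boolP (odd (size l1)); last first.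
  move=> _; rewrite !c3s_cat // -!catA.
  apply: (front [:: c3 x y] [:: c3 y x] (c3s l1) (c3s l2 ++ cs)).
  exact: ceq_join_reverse.
case/lastP: l1 od => // l1 m; rewrite size_rcons /= => od.
case: l2 => [|w l2]; rewrite size_cat /= size_rcons.
  by move=> h; exfalso; lia.
move=> _; rewrite !cat_rcons !c3s_cat // -!catA.
apply: (front [:: c3 m x; c3 y w] [:: c3 m y; c3 x w] (c3s l1) (c3s l2 ++ cs)).
exact: ceq_join_exchange.
Qed.

End Rearrange.
(** * Cycle lengths as a function of the block sizes *)

(* [(cyc s).1] is the length of the excursion of Y from the first position of
   [s] until it leaves [s] to the left, the position following the last block
   being counted as a 1-block; [(cyc s).2] lists the cycles closed in [s]. *)
Fixpoint cyc (s : seq nat) : nat * seq nat :=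
  if s is k :: s' then
    if odd k then (uphalf k, k./2 + (cyc s').1 :: (cyc s').2)
    else ((cyc s').1 + k, (cyc s').2)
  else (1, [::]).

Definition pc (s : seq nat) : seq nat := (cyc s).1 :: (cyc s).2.
Arguments pc : simpl never.

(** A 1-block acts as the end of the word for what precedes it, and the excursion after it closes to
    a cycle of its own. *)
Lemma pc_cat s1 s2 : pc (s1 ++ 1 :: s2) = pc s1 ++ pc s2.
Proof.
suff e : cyc (s1 ++ 1 :: s2) = ((cyc s1).1, (cyc s1).2 ++ pc s2).
  by rewrite /pc e.
by elim: s1 => //= k s1 ->; case: odd.
Qed.

Lemma pc_join cs : cs != [::] -> pc (join cs) = flatten (map pc cs).
Proof.
elim: cs => // c cs ih _; have [->|n0] := eqVneq cs [::].
  by rewrite /= cats0.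
by rewrite join_cons // pc_cat ih.
Qed.

Lemma cyc_twos m s : cyc (twos m ++ s) = ((cyc s).1 + m.*2, (cyc s).2).
Proof.
elim: m => [|m ih] /=; first by rewrite addn0; case: (cyc s).
by rewrite ih /= doubleS addn2 !addnS.
Qed.

Lemma pc_twos m : pc (twos m) = [:: m.*2.+1].
Proof. by rewrite /pc -[twos m]cats0 cyc_twos /= add1n. Qed.

Lemma pc_c3 m l : pc (c3 m l) = [:: m.*2.+2; l.*2.+2].
Proof. by rewrite /pc cyc_twos /= -[twos l]cats0 cyc_twos /= add2n !add1n. Qed.

Lemma pc_4twos m : pc (4 :: twos m) = [:: m.*2 + 5].
Proof. by rewrite /pc /= -[twos m]cats0 cyc_twos /=; congr (_ :: _); lia. Qed.

Lemma pcs_cons c cs : flatten (map pc (c :: cs)) = pc c ++ flatten (map pc cs).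
Proof. by []. Qed.

Lemma pcs_twos ms : flatten [seq pc c | c <- map (fun m => twos m) ms]
  = [seq m.*2.+1 | m <- ms].
Proof. by elim: ms => // m ms ih; rewrite !map_cons pcs_cons ih pc_twos. Qed.

Lemma pcs_c3s e : ~~ odd (size e) ->
  flatten (map pc (c3s e)) = [seq m.*2.+2 | m <- e].
Proof.
have [n] := ubnP (size e); elim: n e => // n ih [|m [|l e]] // lt od.
rewrite [c3s _]/= -/(c3s e) pcs_cons pc_c3.
by rewrite ih //; move: lt od => /=; lia.
Qed.

(** * Chains of the five types *)

Lemma join_chains s : join (chains s) = s.
Proof.
elim: s => //= k s ih; case: eqP => [->|_].
  by rewrite join_cons ?ih //; case: (s) => //= x s'; case: ifP => // _; case: chains.
by case: (chains s) ih => [|c [|c' cs]] /= <-.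
Qed.

Lemma chains_neq0 s : chains s != [::].
Proof. by case: s => //= k s; case: ifP => // _; case: chains. Qed.

Lemma chains_neq1 s : all (fun k => 0 < k) s ->
  all (all (fun k => 1 < k)) (chains s).
Proof.
elim: s => //= k s ih /andP [k0 /ih {}ih]; case: eqP => // /eqP k1.
have k2 : 1 < k by lia.
by case: chains ih => [|c cs] /=; rewrite k2.
Qed.

Lemma all2sP c : all2s c -> c = twos (size c).
Proof. by move/all_pred1P. Qed.

Lemma all2s_map cs : all all2s cs -> cs = map (fun m => twos m) (map size cs).
Proof.
move=> h; rewrite -map_comp -[LHS]map_id; apply/eq_in_map => c hc /=.
by apply: all2sP; apply: (allP h).
Qed.

Lemma form3iP c : form3i c -> exists m l, c = c3 m l.
Proof.
case/andP=> /eqP; elim: c => //= k c ih; case: eqP => [->|_] /=.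
  rewrite add1n => -[c0] c23; exists 0, (size c); congr (_ :: _).
  apply: all2sP; apply/allP => x xc; have := allP c23 x xc.
  case/orP=> // /eqP x3; move/eqP: c0; rewrite -leqn0 leqNgt -has_count.
  by case/hasP; exists x => //; rewrite x3.
rewrite add0n orbF => c1 /andP [/eqP -> c23].
by have [m [l ->]] := ih c1 c23; exists m.+1, l.
Qed.

Lemma form4P c : form4 c -> exists m, c = 4 :: twos m.
Proof. by case: c => //= k c /andP [/eqP -> /all2sP ->]; exists (size c). Qed.

Lemma perm_split (P : pred (seq nat)) cs :
  perm_eq cs (filter P cs ++ filter (predC P) cs).
Proof. by rewrite perm_sym perm_filterC. Qed.

Lemma perm_swap2 (T : eqType) (x y : T) s :
  perm_eq [:: x, y & s] [:: y, x & s].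
Proof. by apply/permP => p /=; rewrite addnCA. Qed.

Lemma size1P (T : Type) (s : seq T) : size s = 1 -> exists x, s = [:: x].
Proof. by case: s => [|x [|y s]] //; exists x. Qed.

Lemma filter_all2s (P : pred (seq nat)) cs :
  all (fun c => P c || all2s c) cs ->
  exists ms, perm_eq cs (filter P cs ++ map (fun m => twos m) ms).
Proof.
move=> h; exists (map size (filter (predC P) cs)); rewrite -all2s_map.
  exact: perm_split.
apply/allP => c; rewrite mem_filter /= => /andP [nP hc].
by have := allP h c hc; rewrite (negPf nP).
Qed.

Lemma form3is_c3s cs : all form3i cs ->
  exists2 e, ~~ odd (size e) & cs = c3s e.
Proof.
elim: cs => [|c cs ih] /=; first by exists [::].
case/andP=> /form3iP [m [l ->]] /ih [e od ->].
by exists [:: m, l & e]; rewrite //= negbK.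
Qed.

Lemma perm_pcs cs cs' : perm_eq cs cs' ->
  perm_eq (flatten (map pc cs)) (flatten (map pc cs')).
Proof. by move=> h; apply/perm_flatten/perm_map. Qed.

Lemma sumn_join (cs : seq (seq nat)) : cs != [::] ->
  (sumn (join cs)).+1 = sumn (flatten cs) + size cs.
Proof.
elim: cs => // c cs ih _; have [->|n0] := eqVneq cs [::].
  by rewrite /= cats0 addn1.
rewrite join_cons // -[flatten _]/(c ++ flatten cs) !sumn_cat /=.
by have := ih n0; lia.
Qed.

Section Types.
Variable A : finType.

(** The number [j] of empty chains is the number of cycles of length 1; the total size then gives
    the size of the only block left, if any. *)
Lemma ceq_type1 cs cs' :
  cs != [::] -> cs' != [::] ->
  all (all (fun k => 1 < k)) cs -> all (all (fun k => 1 < k)) cs' ->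
  count (fun c => c != [::]) cs <= 1 -> count (fun c => c != [::]) cs' <= 1 ->
  all (fun c => (c == [::]) || (size c == 1)) cs ->
  all (fun c => (c == [::]) || (size c == 1)) cs' ->
  sumn (join cs) = sumn (join cs') ->
  perm_eq (flatten (map pc cs)) (flatten (map pc cs')) ->
  ceq A (join cs) (join cs').
Proof.
have norm ds : ds != [::] -> all (all (fun k => 1 < k)) ds ->
  count (fun c => c != [::]) ds <= 1 ->
  all (fun c => (c == [::]) || (size c == 1)) ds ->
  exists f j, [/\ perm_eq ds (f ++ nseq j [::]),
    f = [::] /\ 0 < j \/ exists2 k, 1 < k & f = [:: [:: k]],
    sumn (join ds) = (sumn (flatten f) + size f + j).-1 &
    count_mem 1 (flatten (map pc ds)) = j].
  move=> nd gd cd ad; set f := filter (fun c => c != [::]) ds.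
  set j := size (filter (predC (fun c => c != [::])) ds).
  have pf : perm_eq ds (f ++ nseq j [::]).
    rewrite -(_ : filter (predC (fun c => c != [::])) ds = nseq j [::]).
      exact: perm_split.
    apply/all_pred1P/allP => c; rewrite mem_filter => /andP [].
    by rewrite /= negbK => /eqP ->.
  have sf : size f <= 1 by rewrite size_filter.
  have hf : f = [::] \/ exists2 k, 1 < k & f = [:: [:: k]].
    have ff : all (fun c => (c != [::]) && (c \in ds)) f.
      by apply/allP => c; rewrite mem_filter.
    case: f sf ff {pf} => [|c [|? ?]] //= _; first by left.
    rewrite andbT => /andP [nc hc]; right; have := allP ad c hc; rewrite (negPf nc) /=.
    case/eqP/size1P => k ek; exists k; rewrite ?ek //.
    by have := allP gd c hc; rewrite ek /= andbT.
  have flat0 i : flatten (nseq i [::]) = [::] :> seq nat by elim: i.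
  exists f, j; split=> //.
  - case: hf => [f0|]; [left; split=> //|by right].
    by have := perm_size pf; rewrite f0 size_nseq; case: (ds) nd => //= ? ? _ <-.
  - have := sumn_join nd; rewrite (perm_size pf) (perm_sumn (perm_flatten pf)).
    rewrite flatten_cat sumn_cat size_cat flat0 size_nseq /=; lia.
  - have /permP -> := perm_pcs pf; rewrite map_cat flatten_cat count_cat.
    have -> : count_mem 1 (flatten (map pc (nseq j [::]))) = j.
      by elim: (j) => //= i {2}<-.
    case: hf => [->|[k k1 ->]] //; rewrite pcs_cons cats0.
    (* A single block of size [k] gives [k.+1] for even [k], and [uphalf k], [k./2.+1] for odd [k];
       none is 1 as [k] exceeds 1. *)
    rewrite (_ : count_mem 1 (pc [:: k]) = 0) //; apply/count_memPn.
    by rewrite /pc /=; case: ifP => ok /=; rewrite !inE ?uphalf_half; lia.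
move=> n0 n0' g g' c c' a a' es ep.
have [f [j [pf hf sf cf]]] := norm _ n0 g c a.
have [f' [j' [pf' hf' sf' cf']]] := norm _ n0' g' c' a'.
have ej : j = j' by rewrite -cf -cf'; apply/permP.
move: pf' hf' sf'; rewrite -{}ej => pf' hf' sf'; suff ff : f = f'.
  by apply/ceq_join_perm/(perm_trans pf); rewrite ff perm_sym.
rewrite es sf' in sf.
case: hf hf' sf => [[-> j0]|[k k1 ->]] [[-> j0']|[k' k1' ->]] //= h.
- by exfalso; move: h => /=; lia.
- by exfalso; move: h => /=; lia.
- by congr [:: [:: _]]; move: h => /=; lia.
Qed.

Lemma ceq_twos ms ms' fs :
  perm_eq [seq m.*2.+1 | m <- ms] [seq m.*2.+1 | m <- ms'] ->
  ceq A (join (fs ++ map (fun m => twos m) ms))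
        (join (fs ++ map (fun m => twos m) ms')).
Proof.
move=> h; apply: ceq_join_perm; rewrite perm_cat2l; apply: perm_map.
by move: h; apply: perm_map_inj => x y; lia.
Qed.

Lemma ceq_type2 cs cs' :
  all all2s cs -> all all2s cs' ->
  perm_eq (flatten (map pc cs)) (flatten (map pc cs')) ->
  ceq A (join cs) (join cs').
Proof.
move=> /all2s_map -> /all2s_map ->; rewrite !pcs_twos => h.
exact: (ceq_twos [::]).
Qed.

(** Chains with a 3-block give even cycle lengths and the others odd ones, so filtering by parity
    recovers the two lists of exponents separately. *)
Lemma ceq_type3 cs cs' :
  all (fun c => (c == [::]) || form3i c || form3ii c) cs ->
  all (fun c => (c == [::]) || form3i c || form3ii c) cs' ->
  perm_eq (flatten (map pc cs)) (flatten (map pc cs')) ->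
  ceq A (join cs) (join cs').
Proof.
have norm ds : all (fun c => (c == [::]) || form3i c || form3ii c) ds ->
    exists e ms, ~~ odd (size e) /\
      perm_eq ds (c3s e ++ map (fun m => twos m) ms).
  move=> h; have {}h : all (fun c => form3i c || all2s c) ds.
    by apply: sub_all h => c /orP [/orP [/eqP ->|->] //|/andP [_ ->]]; rewrite orbT.
  have [ms pms] := filter_all2s h.
  have [e od ee] := form3is_c3s (filter_all form3i ds).
  by exists e, ms; rewrite -ee.
move=> /norm [e [ms [od p]]] /norm [e' [ms' [od' p']]] ep.
have {ep} : perm_eq ([seq m.*2.+2 | m <- e] ++ [seq m.*2.+1 | m <- ms])
                    ([seq m.*2.+2 | m <- e'] ++ [seq m.*2.+1 | m <- ms']).
  rewrite -!pcs_c3s // -!pcs_twos -!flatten_cat -!map_cat.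
  by rewrite -(permPl (perm_pcs p)) -(permPr (perm_pcs p')).
move=> ep; apply: ceq_trans (ceq_join_perm A p) _.
apply: ceq_trans (ceq_sym (ceq_join_perm A p')).
have ev x : [seq y <- [seq m.*2.+2 | m <- x] | ~~ odd y] = [seq m.*2.+2 | m <- x].
  by apply/all_filterP/allP => y /mapP [z _ ->]; lia.
have ev' x : [seq y <- [seq m.*2.+2 | m <- x] | odd y] = [::].
  rewrite -(filter_pred0 [seq m.*2.+2 | m <- x]).
  by apply: eq_in_filter => y /mapP [z _ ->]; rewrite /= negbK odd_double.
have odm x : [seq y <- [seq m.*2.+1 | m <- x] | odd y] = [seq m.*2.+1 | m <- x].
  by apply/all_filterP/allP => y /mapP [z _ ->]; lia.
have odm' x : [seq y <- [seq m.*2.+1 | m <- x] | ~~ odd y] = [::].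
  rewrite -(filter_pred0 [seq m.*2.+1 | m <- x]).
  by apply: eq_in_filter => y /mapP [z _ ->]; rewrite /= negbK odd_double.
have := perm_filter (fun y => ~~ odd y) ep.
have := perm_filter odd ep.
rewrite !filter_cat !ev !ev' !odm !odm' !cats0 /= => pms pe.
apply: ceq_trans (ceq_twos (c3s e) pms) _.
apply: ceq_join_c3s => //; move: pe; apply: perm_map_inj => x y; lia.
Qed.

(** A 4-block followed by [m] 2-blocks has the cycle length of a chain of [m.+2] 2-blocks. The
    lengths therefore do not tell which chain has the 4-block, and [ceq_join_move4] moves it. *)
Lemma ceq_type4 cs cs' :
  count form4 cs == 1 -> all (fun c => form4 c || all2s c) cs ->
  count form4 cs' == 1 -> all (fun c => form4 c || all2s c) cs' ->
  perm_eq (flatten (map pc cs)) (flatten (map pc cs')) ->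
  ceq A (join cs) (join cs').
Proof.
have norm ds : count form4 ds == 1 -> all (fun c => form4 c || all2s c) ds ->
    exists m ms, perm_eq ds ((4 :: twos m) :: map (fun m => twos m) ms).
  rewrite -size_filter => /eqP /size1P [c ec] /filter_all2s [ms].
  have : form4 c by have := filter_all form4 ds; rewrite ec /= andbT.
  by move=> /form4P [m ecm]; rewrite ec ecm; exists m, ms.
move=> c a c' a' ep.
have [m [ms p]] := norm _ c a; have [m' [ms' p']] := norm _ c' a'.
have {ep} : perm_eq [seq m.*2.+1 | m <- m.+2 :: ms]
                    [seq m.*2.+1 | m <- m'.+2 :: ms'].
  have e4 x xs : [seq m.*2.+1 | m <- x.+2 :: xs] =
      flatten (map pc ((4 :: twos x) :: map (fun m => twos m) xs)).
    by rewrite pcs_cons pc_4twos pcs_twos /=; congr (_ :: _); lia.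
  rewrite !e4; apply: perm_trans (perm_pcs p'); apply: perm_trans ep.
  by rewrite perm_sym perm_pcs.
have inj : injective (fun m => m.*2.+1) by move=> x y; lia.
move/(perm_map_inj inj) => ep; apply: ceq_trans (ceq_join_perm A p) _.
apply: ceq_trans (ceq_sym (ceq_join_perm A p')).
have [em|nm] := eqVneq m m'.
  move: ep; rewrite em perm_cons => h; apply: (ceq_join_perm A).
  by rewrite perm_cons perm_map.
(* For [m] different from [m'], the length of the chain with the 4-block on one side is that of a
   chain of 2-blocks on the other. *)
have mi : m'.+2 \in ms.
  have : m'.+2 \in m.+2 :: ms by rewrite (perm_mem ep) mem_head.
  by rewrite inE => /orP [/eqP [e]|//]; rewrite e eqxx in nm.
set r := rem m'.+2 ms; have pr : perm_eq ms (m'.+2 :: r) by apply: perm_to_rem.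
have pr' : perm_eq ms' (m.+2 :: r).
  rewrite -(perm_cons m'.+2) -(permPl ep); apply: perm_trans (perm_swap2 _ _ _).
  by rewrite perm_cons.
have q x s s' : perm_eq s s' ->
  ceq A (join (x :: map (fun m => twos m) s)) (join (x :: map (fun m => twos m) s')).
  by move=> h; apply: ceq_join_perm; rewrite perm_cons perm_map.
apply: ceq_trans (q _ _ _ pr) _; apply: ceq_trans (ceq_sym (q _ _ _ pr')).
apply: ceq_trans (ceq_join_move4 _ _ _ _) _; apply: ceq_join_perm.
exact: perm_swap2.
Qed.

(** The 5-block contributes the lengths 3 and 3 on both sides; these cancel. *)
Lemma ceq_type5 cs cs' :
  count (fun c => c == [:: 5]) cs == 1 ->
  all (fun c => (c == [:: 5]) || (c == [::]) || (c == [:: 2])) cs ->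
  count (fun c => c == [:: 5]) cs' == 1 ->
  all (fun c => (c == [:: 5]) || (c == [::]) || (c == [:: 2])) cs' ->
  perm_eq (flatten (map pc cs)) (flatten (map pc cs')) ->
  ceq A (join cs) (join cs').
Proof.
have norm ds : count (fun c => c == [:: 5]) ds == 1 ->
    all (fun c => (c == [:: 5]) || (c == [::]) || (c == [:: 2])) ds ->
    exists ms, perm_eq ds ([:: 5] :: map (fun m => twos m) ms).
  rewrite -size_filter => /eqP /size1P [c ec] h.
  have {h} : all (fun c => (c == [:: 5]) || all2s c) ds.
    by apply: sub_all h => d /orP [/orP [->|/eqP ->] //|/eqP ->]; rewrite orbT.
  case/filter_all2s => ms; rewrite ec.
  have := filter_all (fun c => c == [:: 5]) ds; rewrite ec /= andbT => /eqP ->.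
  by exists ms.
move=> c a c' a' ep.
have [ms p] := norm _ c a; have [ms' p'] := norm _ c' a'.
apply: ceq_trans (ceq_join_perm A p) _.
apply: ceq_trans (ceq_sym (ceq_join_perm A p')).
apply: (ceq_twos [:: [:: 5]]).
have e5 xs : flatten (map pc ([:: 5] :: map (fun m => twos m) xs)) =
    [:: 3; 3] ++ [seq m.*2.+1 | m <- xs] by rewrite pcs_cons pcs_twos.
rewrite -(perm_cat2l [:: 3; 3]) -!e5; apply: perm_trans (perm_pcs p').
by apply: perm_trans ep; rewrite perm_sym perm_pcs.
Qed.

Lemma ceq_type t s s' :
  all (fun k => 0 < k) s -> all (fun k => 0 < k) s' -> sumn s = sumn s' ->
  has_type_sizes t s -> has_type_sizes t s' -> perm_eq (pc s) (pc s') ->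
  ceq A s s'.
Proof.
move=> /chains_neq1 g /chains_neq1 g' es.
have n0 := chains_neq0 s; have n0' := chains_neq0 s'.
rewrite /has_type_sizes => h h' p.
have {p} : perm_eq (flatten (map pc (chains s))) (flatten (map pc (chains s'))).
  by rewrite -!pc_join // !join_chains.
suff: perm_eq (flatten (map pc (chains s))) (flatten (map pc (chains s'))) ->
    ceq A (join (chains s)) (join (chains s')) by rewrite !join_chains.
case: t h h'.
- by move=> /andP [c a] /andP [c' a']; apply: ceq_type1; rewrite ?join_chains.
- by move=> /andP [_ a] /andP [_ a']; apply: ceq_type2.
- by move=> /and3P [_ a _] /and3P [_ a' _]; apply: ceq_type3.
- by move=> /and3P [_ c a] /and3P [_ c' a']; apply: ceq_type4.
- by move=> /and3P [_ c a] /and3P [_ c' a']; apply: ceq_type5.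
Qed.

End Types.
(** * Excursions of Y *)

(** Progressions of step 2: inside a block, Y advances by two positions. *)
Fixpoint ap (a m : nat) : seq nat := if m is m'.+1 then a :: ap a.+2 m' else [::].

Lemma perm_ap_even a m : perm_eq (ap a m ++ ap a.+1 m) (iota a m.*2).
Proof.
elim: m a => //= m ih a; rewrite perm_cons; apply/permP => P.
by have /permP/(_ P) := ih a.+2; rewrite !count_cat /=; lia.
Qed.

Lemma perm_ap_odd a m : perm_eq (ap a m.+1 ++ ap a.+1 m) (iota a m.*2.+1).
Proof. by rewrite /= perm_cons perm_catC; apply: perm_ap_even. Qed.

Section Excursions.
Variables (A : finType) (g : A -> A) (x : nat -> A).

Definition yrel i j := g (x i) == x j.

Lemma ap_path a m : (forall i, a <= i < a + m.*2 -> yrel i i.+2) ->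
  path yrel a (ap a.+2 m) /\ last a (ap a.+2 m) = a + m.*2.
Proof.
elim: m a => [|m ih] a h /=; first by rewrite addn0.
rewrite h ?leqnn /=; last by lia.
have [|-> ->] := ih a.+2; first by move=> i hi; apply: h; lia.
by split=> //; lia.
Qed.

(* Y on blocks of sizes [s] starting at position [lo], the preceding block
   starting at position [pb]. *)
Fixpoint yblocks (pb lo : nat) (s : seq nat) : Prop :=
  if s is k :: s' then
    [/\ 0 < k, forall i, lo <= i -> i.+1 < lo + k -> yrel i i.+2,
        yrel (lo + k).-1 pb.+1 & yblocks lo (lo + k) s']
  else yrel lo pb.+1.

Lemma excursion s pb lo : yblocks pb lo s -> exists l cls,
  [/\ perm_eq (lo :: l ++ flatten cls) (iota lo (sumn s).+1),
      path yrel lo l, yrel (last lo l) pb.+1,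
      all (fun c => (c != [::]) && cycle yrel c) cls &
      (size l).+1 = (cyc s).1 /\ map size cls = (cyc s).2].
Proof.
elim: s pb lo => [|k s ih] pb lo; first by exists [::], [::].
case=> k0 step back /ih [e [cls [pe pae lae clc [se scl]]]].
have := odd_double_half k; case: (boolP (odd k)) => ok kE.
  have [pa la] : path yrel lo (ap lo.+2 k./2) /\
      last lo (ap lo.+2 k./2) = lo + k./2.*2.
    by apply: ap_path => i hi; apply: step; lia.
  (* For odd [k] the progression from [lo] leaves at once, and the one from [lo.+1] closes up with
     the next excursion. *)
  exists (ap lo.+2 k./2), ((ap lo.+1 k./2 ++ lo + k :: e) :: cls).
  have sap a m : size (ap a m) = m by elim: m a => //= m ihm a; rewrite ihm.
  split=> //.
  - apply/permP => P; have /permP/(_ P) := pe; have /permP/(_ P) := perm_ap_odd lo k./2.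
    have -> : iota lo (sumn (k :: s)).+1 =
        iota lo k./2.*2.+1 ++ iota (lo + k) (sumn s).+1.
      have ek : k = k./2.*2.+1 by lia.
      by rewrite [sumn _]/= -addnS iotaD [in iota lo k]ek.
    by rewrite /= !(count_cat, =^~ cat_cons) /=; lia.
  - by rewrite la; have -> : lo + k./2.*2 = (lo + k).-1 by lia.
  - apply/andP; split=> //; apply/andP; split; first by case: (ap _ _).
    case ek : k./2 => [|j] /=.
      (* For [k = 1] the progression from [lo.+1] is empty and the next excursion is itself the
         cycle. *)
      rewrite rcons_path pae /=; move: lae.
      by have -> : lo + k = lo.+1 by lia.
    have [pa' la'] : path yrel lo.+1 (ap lo.+3 j) /\
        last lo.+1 (ap lo.+3 j) = lo.+1 + j.*2.
      by apply: ap_path => i hi; apply: step; lia.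
    rewrite rcons_path cat_path pa' la' /= pae andbT last_cat /= lae andbT.
    have -> : lo + k = (lo.+1 + j.*2).+2 by lia.
    by apply: step; lia.
  - by rewrite /= size_cat !sap /= se scl uphalf_half ok; split=> //; lia.
have [j ej] : exists j, k = j.+1.*2 by exists (k./2.-1); lia.
have [pa la] : path yrel lo (ap lo.+2 j) /\ last lo (ap lo.+2 j) = lo + j.*2.
  by apply: ap_path => i hi; apply: step; lia.
have [pa' la'] : path yrel lo.+1 (ap lo.+3 j) /\
        last lo.+1 (ap lo.+3 j) = lo.+1 + j.*2.
  by apply: ap_path => i hi; apply: step; lia.
have sap a m : size (ap a m) = m by elim: m a => //= m ihm a; rewrite ihm.
(* For even [k] everything is one excursion: even offsets, next blocks, odd offsets. *)
exists (ap lo.+2 j ++ lo + k :: e ++ ap lo.+1 j.+1), cls; split=> //.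
- apply/permP => P; have /permP/(_ P) := pe; have /permP/(_ P) := perm_ap_even lo j.+1.
  have -> : iota lo (sumn (k :: s)).+1 = iota lo j.+1.*2 ++ iota (lo + k) (sumn s).+1.
    by rewrite [sumn _]/= -addnS iotaD ej.
  by rewrite /= !(count_cat, =^~ cat_cons) /= ?count_cat /=; lia.
- rewrite cat_path pa la /= cat_path pae /= lae pa' !andbT.
  have -> : lo + k = (lo + j.*2).+2 by lia.
  by apply: step; lia.
- rewrite last_cat /= last_cat /= la'.
  by have -> : lo.+1 + j.*2 = (lo + k).-1 by lia.
- rewrite [cyc (k :: s)]/= (negPf ok) size_cat /= size_cat /= !sap scl.
  by split=> //; lia.
Qed.

End Excursions.

(** Each cycle contains exactly one element equal to its [froot], and the order of that element is
    the size of the cycle. *)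
Lemma cycle_orders (A : finType) (f : A -> A) (D : pred A) css :
  all (fun c => (c != [::]) && fcycle f c) css -> uniq (flatten css) ->
  flatten css =i D ->
  perm_eq [seq order f y | y <- enum A & D y && (froot f y == y)] (map size css).
Proof.
move=> cc uc cD.
have pD : perm_eq (flatten css) (filter D (enum A)).
  apply: uniq_perm => //; first exact/filter_uniq/enum_uniq.
  by move=> y; rewrite cD mem_filter mem_enum andbT.
have -> : [seq y <- enum A | D y && (froot f y == y)] =
          [seq y <- [seq y <- enum A | D y] | froot f y == y].
  by rewrite -filter_predI; apply: eq_filter => y /=; rewrite andbC.
apply: perm_trans (perm_map _ (perm_filter _ _)) _.
  by rewrite perm_sym; apply: pD.
move: cc uc; elim: (css) => //= c cs ih /andP [/andP [nc fc] /ih {}ih].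
rewrite cat_uniq => /and3P [uc _ /ih {}ih].
rewrite filter_cat map_cat -cat1s; apply: perm_cat => //.
have cE y z : y \in c -> z \in c -> froot f y = froot f z.
  move=> yc zc; rewrite /root; have e : fconnect f y =1 fconnect f z.
    by move=> w; rewrite !(fconnect_cycle fc).
  by rewrite (eq_pick e); case: pickP => // /(_ z); rewrite connect0.
case: c nc fc uc cE => // y c _ fc uc cE.
have ryc : froot f y \in y :: c.
  by rewrite -(fconnect_cycle fc (mem_head y c)); apply: connect_root.
have -> : [seq z <- y :: c | froot f z == z] = [:: froot f y].
  rewrite -(filter_pred1_uniq uc ryc); apply: eq_in_filter => z zc /=.
  by rewrite (cE z y) ?mem_head // eq_sym.
by rewrite /= (order_cycle fc uc ryc).
Qed.
(** * Pairs of rows as pairs of words *)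

Section Rows.
Variable A : finType.
Implicit Types (f pe po : A -> nat) (t b : seq A) (p : pair A).

Definition row f t := full t /\ forall a, f a = (index a t).+1.

Lemma row_map f t : map f t = iota 1 #|A| -> row f t.
Proof.
move=> e; have st : size t = #|A| by rewrite -(size_map f) e size_iota.
have ft : full t.
  by rewrite /full st eqxx andbT; apply: (@map_uniq _ _ f); rewrite e iota_uniq.
split=> // a; have ai : index a t < size t by rewrite index_mem full_mem.
by rewrite -{1}(nth_index a (full_mem a ft)) -(nth_map a 0) // e nth_iota -?st.
Qed.

Lemma map_row f t : row f t -> map f t = iota 1 #|A|.
Proof.
case=> /andP [ut /eqP st] h; apply: (@eq_from_nth _ 0).
  by rewrite size_map size_iota.
rewrite size_map => i hi; case: t => [|a t] // in ut st h hi *.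
by rewrite (nth_map a) // h index_uniq // nth_iota -?st.
Qed.

Lemma row_ex f : bij1n f -> exists t, row f t.
Proof.
case=> fi fr; exists (sort (relpre f leq) (enum A)); apply: row_map.
rewrite -sort_map; apply: (sorted_eq leq_trans anti_leq).
- exact/sort_sorted/leq_total.
- exact: iota_sorted.
(* As many distinct values as there are integers from 1 to [#|A|], all in that range, so every
   integer is attained. *)
have ue : uniq (map f (enum A)) by rewrite map_inj_uniq // enum_uniq.
have [] := uniq_min_size ue (s2 := iota 1 #|A|).
- by move=> _ /mapP [a _ ->]; rewrite mem_iota add1n ltnS; apply: fr.
- by rewrite size_iota size_map -cardE.
move=> _ e; rewrite perm_sort; apply: uniq_perm => //; exact: iota_uniq.
Qed.

Lemma row_inj f t : row f t -> injective f.
Proof.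
case=> ft h a b; rewrite !h => -[e].
by rewrite -(nth_index a (full_mem a ft)) e nth_index // full_mem.
Qed.

Lemma row_bij f t : row f t -> bij1n f.
Proof.
move=> h; split; first exact: row_inj h.
case: h => ft h a; rewrite h /=.
by have /andP [_ /eqP <-] := ft; rewrite index_mem full_mem.
Qed.

Lemma inv_some f k a : injective f -> f a = k -> Defs.inv f k = Some a.
Proof.
move=> fi e; rewrite /Defs.inv; case: pickP => [b /eqP|/(_ a)]; last by rewrite e eqxx.
by rewrite -e => /fi ->.
Qed.

Lemma invd_eq f k a d : injective f -> f a = k -> invd f k d = a.
Proof. by move=> fi e; rewrite /invd (inv_some fi e). Qed.

Lemma row_last f t x : row f (rcons t x) -> f x = #|A|.
Proof.
case=> /andP [ue /eqP <-] ->; rewrite -cats1 index_cat.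
move: ue; rewrite rcons_uniq => /andP [/negPf -> _].
by rewrite size_cat /= eqxx addn0 addn1.
Qed.

Lemma rmove_row_last pe po t x P :
  row pe (rcons t x) -> row po (rcons P x) -> row (rmove_row pe po) (rcons P x).
Proof.
move=> he ho; have ie := row_inj he; have [fo vo] := ho.
have /andP [uo /eqP so] := fo; have px := row_last he.
split=> // a; rewrite /rmove_row (inv_some ie px) !vo.
have : index a (rcons P x) < size (rcons P x) by rewrite index_mem full_mem.
have -> : index x (rcons P x) = size P.
  move: uo; rewrite -cats1 index_cat cats1 rcons_uniq /= eqxx addn0.
  by case/andP=> /negPf ->.
by rewrite size_rcons !ltnS => ->.
Qed.

(** One Rauzy move rotates the part after [x] by one letter; iterated, it gives [weq_right]. *)
Lemma rmove_row_step pe po t x P Q y :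
  row pe (rcons t x) -> row po (P ++ x :: rcons Q y) ->
  row (rmove_row pe po) (P ++ x :: y :: Q).
Proof.
move=> he ho; have ie := row_inj he; have [fo vo] := ho.
have /andP [uo /eqP so] := fo; have px := row_last he.
have pp : perm_eq (P ++ x :: rcons Q y) (P ++ x :: y :: Q).
  by rewrite perm_cat2l perm_cons perm_rcons.
split=> [|a]; first by rewrite /full -(perm_uniq pp) -(perm_size pp).
have am : a \in P ++ x :: rcons Q y by rewrite full_mem.
rewrite /rmove_row (inv_some ie px) !vo -so size_cat /= size_rcons.
move: uo am; rewrite cat_uniq /= rcons_uniq mem_rcons !inE has_rcons !negb_or.
case/and3P=> _ /and3P [xP yP QP] /and3P [/andP [xy xQ] yQ uQ].
rewrite mem_cat inE mem_rcons inE.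
rewrite !index_cat (negPf xP) /= eqxx addn0.
have [aP|aP] := boolP (a \in P).
  by move=> _; rewrite ifT // ltnS index_size.
rewrite orFb.
rewrite (eq_sym a x); case: (eqVneq x a) => [<-|xa] /=; first by rewrite addn0 leqnn.
rewrite -cats1 index_cat (eq_sym a y); case: (eqVneq y a) => [ya|ya] /=.
  rewrite -ya (negPf yQ) eqxx addn0 => _; move: (size P) (size Q); clear=> m n.
  by case: ifP; [lia | case: ifP; lia].
move=> aQ; have : index a Q < size Q by rewrite index_mem.
rewrite aQ; move: (size P) (size Q) (index a Q); clear=> m n i.
by case: ifP; [lia | case: ifP; lia].
Qed.

Lemma lmove_row_step pe po t x P Q y :
  row pe (x :: t) -> row po (y :: P ++ x :: Q) ->
  row (lmove_row pe po) (P ++ y :: x :: Q).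
Proof.
move=> he ho; have ie := row_inj he; have [fe ve] := he; have [fo vo] := ho.
have /andP [uo /eqP so] := fo.
have px : pe x = 1 by rewrite ve /= eqxx.
have pp : perm_eq (y :: P ++ x :: Q) (P ++ y :: x :: Q).
  by rewrite -cat1s perm_catCA.
split=> [|a]; first by rewrite /full -(perm_uniq pp) -(perm_size pp).
have am : a \in y :: P ++ x :: Q by rewrite full_mem.
rewrite /lmove_row (inv_some ie px) !vo /=.
move: uo am; rewrite /= cat_uniq /= mem_cat !inE !negb_or.
case/andP=> /and3P [yP yx yQ] /and3P [_ /andP [xP _] /andP [xQ _]].
rewrite !index_cat (negPf xP) (negPf yx) /= eqxx addn0 mem_cat inE (eq_sym a y).
case: (eqVneq y a) => [<-|ya] /=; first by rewrite (negPf yP) addn0.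
have [aP|aP] := boolP (a \in P).
  by move=> _; rewrite ifT // !ltnS index_mem.
rewrite orFb.
rewrite (eq_sym a x); case: (eqVneq x a) => [<-|xa] /= _.
  by rewrite addn0 ltnn addn1.
move: (size P) (index a Q); clear=> m i.
by case: ifP; lia.
Qed.

(** * Reachability *)

Definition rep p (w : seq A * seq A) := row p.1 w.1 /\ row p.2 w.2.
Definition swap p : pair A := (p.2, p.1).

Lemma ext_reach_trans p q r : ext_reach p q -> ext_reach q r -> ext_reach p r.
Proof. by move=> pq; elim=> // ? ? _; [apply: ext_rauzy|apply: ext_lrauzy]. Qed.

Lemma ext_reach_swap p q : ext_reach p q -> ext_reach (swap p) (swap q).
Proof.
elim=> [|r e _ h|r e _ h]; first exact: ext_refl.
- have -> : swap (rauzy e r) = rauzy (~~ e) (swap r) by case: e.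
  exact: ext_rauzy.
- have -> : swap (lrauzy e r) = lrauzy (~~ e) (swap r) by case: e.
  exact: ext_lrauzy.
Qed.

(** A rotation is realized letter by letter: the last letters of the bottom row jump behind [x], or
    the first ones in front of [x]. Exchanging the rows exchanges the two types of moves. *)
Lemma weq_reach w w' p : weq w w' -> rep p w ->
  exists2 q, ext_reach p q & rep q w'.
Proof.
move=> h; elim: h p => {w w'}
  [w|w1 w2 w3 _ h1 _ h2|t b t' b' _ h|t x P Q1 Q2|t x P1 P2 Q] p hp.
- by exists p => //; apply: ext_refl.
- have [q pq /h2 [r qr hr]] := h1 p hp; exists r => //.
  exact: ext_reach_trans pq qr.
- have [|q pq [q1 q2]] := h (swap p); first by case: hp.
  exists (swap q) => //; case: p {h hp} pq => p1 p2 pq.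
  exact: (ext_reach_swap pq).
- elim/last_ind: Q2 Q1 p hp => [|Q2 y ih] Q1 p hp.
    by exists p; [apply: ext_refl|rewrite cats0 in hp].
  case: hp => /= h1 h2; rewrite -rcons_cat in h2.
  have [|q pq hq] := ih (y :: Q1) (rauzy false p).
    by split=> //=; apply: rmove_row_step h1 h2.
  exists q; last by rewrite cat_rcons.
  exact: ext_reach_trans (ext_rauzy false (ext_refl p)) pq.
- elim: P1 P2 p hp => [|y P1 ih] P2 p hp; first by exists p => //; apply: ext_refl.
  case: hp => /= h1 h2; rewrite catA in h2.
  have [|q pq hq] := ih (rcons P2 y) (lrauzy false p).
    split=> //=; have := lmove_row_step h1 h2; by rewrite cat_rcons -catA.
  exists q; last by rewrite -cat_rcons.
  exact: ext_reach_trans (ext_lrauzy false (ext_refl p)) pq.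
Qed.

End Rows.

(** * Irreducibility along moves, and invariance of classes under relabeling *)

Section Classes.
Variable A : finType.
Implicit Types (p q r : pair A) (f : A -> A).

Definition valid p := is_pair p /\ irreducible p.

Lemma valid_swap p : valid p -> valid (swap p).
Proof.
case=> -[h1 h2] irr; split; first by split.
by move=> k /irr [a]; exists a; rewrite eq_sym.
Qed.

Lemma valid_rauzy_false p : 2 <= #|A| -> valid p -> valid (rauzy false p).
Proof.
move=> n2 [[h1 h2] irr]; have [t rt] := row_ex h1; have [b rb] := row_ex h2.
have [i1 i2] := (row_inj rt, row_inj rb).
case/lastP: t => [|t x] in rt *.
  by case: rt => /andP [_ /eqP e] _; rewrite -e in n2.
have xb : x \in b by apply: full_mem; case: rb.
have px := row_last rt; split.
  split=> //=; case/splitPr: xb rb => P Q; case/lastP: Q => [|Q y] rb.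
    apply: (@row_bij _ _ (rcons P x)); apply: rmove_row_last rt _.
    by rewrite -cats1.
  exact/row_bij/(rmove_row_step rt rb).
move=> k hk; have [a ha] := irr k hk; rewrite /= /rmove_row (inv_some i1 px).
(* Below the position of [x] the bottom row is unchanged, so the old witness [a] works; from there
   on [x] itself works, being last on top. *)
have [kx|xk] := ltnP k (p.2 x).
  exists a; move: ha; case: ifP => // ax; case: ifP => _; do 2!case: leqP; lia.
exists x; rewrite leqnn px xk leqNgt; by case/andP: hk => _ ->.
Qed.

Lemma valid_lrauzy_false p : 2 <= #|A| -> valid p -> valid (lrauzy false p).
Proof.
move=> n2 [[h1 h2] irr]; have [t rt] := row_ex h1; have [b rb] := row_ex h2.
have [i1 i2] := (row_inj rt, row_inj rb).
case: t => [|x t] in rt *.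
  by case: rt => /andP [_ /eqP e] _; rewrite -e in n2.
have xb : x \in b by apply: full_mem; case: rb.
have px : p.1 x = 1 by have [_ ->] := rt; rewrite /= eqxx.
(* Irreducibility at [k = 1]: the rows begin with different letters. Otherwise the left move would
   produce position 0. *)
have x1 : 1 < p.2 x.
  rewrite ltnNge; apply/negP => x1; have [|a] := irr 1; first by lia.
  have [[_ r1] [_ r2]] := (h1, h2).
  case: (eqVneq a x) => [->|ax]; first by rewrite px x1.
  have n1 : p.1 a != 1 by rewrite -px (inj_eq i1).
  have e2 : p.2 x = 1 by have := r2 x; lia.
  have n3 : p.2 a != 1 by rewrite -e2 (inj_eq i2).
  have := r1 a; have := r2 a; do 2!case: leqP; lia.
split.
  split=> //=; case/splitPr: xb rb => -[|y P] Q rb.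
    by have [_ e] := rb; move: x1; rewrite e /= eqxx.
  exact/row_bij/(lmove_row_step rt rb).
move=> k hk; have [a ha] := irr k hk; rewrite /= /lmove_row (inv_some i1 px).
have [kx|xk] := ltnP k (p.2 x).
  exists x; rewrite px ltnn ifF; last by lia.
  by do 2!case: leqP; lia.
exists a; rewrite [X in _ != X](_ : _ = (p.2 a <= k)) //; move: hk xk {ha}.
move: (p.2 a) (p.2 x) #|A|; clear=> v w m hk xk.
by case: eqP => [->|_]; [lia | case: ifP; lia].
Qed.

Lemma valid_move p e : 2 <= #|A| -> valid p ->
  valid (rauzy e p) /\ valid (lrauzy e p).
Proof.
move=> n2 v; case: e; last by split; [exact: valid_rauzy_false|exact: valid_lrauzy_false].
have vs := valid_swap v; split.
  exact: valid_swap (valid_rauzy_false n2 vs).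
exact: valid_swap (valid_lrauzy_false n2 vs).
Qed.

Lemma valid_reach p q : 2 <= #|A| -> ext_reach p q -> valid p -> valid q.
Proof.
move=> n2 h v; elim: h => // r e _ /(valid_move e n2) [] //.
Qed.

Definition relabels f p q := forall a, q.1 (f a) = p.1 a /\ q.2 (f a) = p.2 a.

Lemma pair_surj (g : A -> nat) k : bij1n g -> 1 <= k <= #|A| -> exists a, g a = k.
Proof.
move=> /row_ex [t rt] hk; have : k \in map g t by rewrite (map_row rt) mem_iota; lia.
by case/mapP=> a _ ->; exists a.
Qed.

Lemma relabels_move f p q e : 2 <= #|A| -> is_pair p -> is_pair q ->
  relabels f p q ->
  relabels f (rauzy e p) (rauzy e q) /\ relabels f (lrauzy e p) (lrauzy e q).
Proof.
move=> n2 [p1 p2] [q1 q2] h.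
have inv1 k : 1 <= k <= #|A| ->
    exists a, Defs.inv p.1 k = Some a /\ Defs.inv q.1 k = Some (f a).
  case/(pair_surj p1)=> a ea; exists a; rewrite (inv_some p1.1 ea).
  by rewrite (@inv_some _ _ _ (f a) q1.1) //; case: (h a) => ->.
have inv2 k : 1 <= k <= #|A| ->
    exists a, Defs.inv p.2 k = Some a /\ Defs.inv q.2 k = Some (f a).
  case/(pair_surj p2)=> a ea; exists a; rewrite (inv_some p2.1 ea).
  by rewrite (@inv_some _ _ _ (f a) q2.1) //; case: (h a) => _ ->.
have [h1 h2] : (forall a, q.1 (f a) = p.1 a) /\ (forall a, q.2 (f a) = p.2 a).
  by split=> a; case: (h a).
have [|a1 [pa1 qa1]] := inv1 1; first by lia.
have [|a2 [pa2 qa2]] := inv2 1; first by lia.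
have [|b1 [pb1 qb1]] := inv1 #|A|; first by lia.
have [|b2 [pb2 qb2]] := inv2 #|A|; first by lia.
case: e; split=> a; rewrite /= /rmove_row /lmove_row ?pa1 ?pa2 ?pb1 ?pb2;
  by rewrite ?qa1 ?qa2 ?qb1 ?qb2 !(h1, h2).
Qed.

Lemma pmap_row (g : A -> nat) t : row g t -> pmap (Defs.inv g) (iota 1 #|A|) = t.
Proof.
move=> rt; have gi := row_inj rt; rewrite -(map_row rt).
by elim: (t) => //= a s ->; rewrite (inv_some gi erefl).
Qed.

Lemma relabels_nonlab f p q : injective f -> is_pair p -> relabels f p q ->
  nonlab p = nonlab q.
Proof.
move=> fi [/row_ex [t rt] _] h.
have rt' : row q.1 (map f t).
  apply: row_map; rewrite -map_comp -(map_row rt); apply/eq_map => a /=.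
  by case: (h a).
rewrite /nonlab (pmap_row rt) (pmap_row rt') -map_comp.
by apply/eq_map => a /=; case: (h a).
Qed.

(** The same moves are performed on both pairs; validity is carried along because a relabeling is
    compatible with a move when all positions are attained. *)
Lemma relabels_class f p q s : 2 <= #|A| -> injective f -> valid p -> valid q ->
  relabels f p q -> nonlab_class p s -> nonlab_class q s.
Proof.
move=> n2 fi vp vq h [r pr <-].
suff [r' qr [hr vr _]] : exists2 r', ext_reach q r' &
    [/\ relabels f r r', valid r & valid r'].
  by exists r' => //; rewrite (relabels_nonlab fi _ hr) //; case: vr.
elim: pr => [|r1 e _ [r' qr [hr vr vr']]|r1 e _ [r' qr [hr vr vr']]].
- by exists q => //; apply: ext_refl.
- exists (rauzy e r'); first exact: ext_rauzy.
  split; [exact: (relabels_move e n2 vr.1 vr'.1 hr).1| |].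
    exact: (valid_move e n2 vr).1.
  exact: (valid_move e n2 vr').1.
- exists (lrauzy e r'); first exact: ext_lrauzy.
  split; [exact: (relabels_move e n2 vr.1 vr'.1 hr).2| |].
    exact: (valid_move e n2 vr).2.
  exact: (valid_move e n2 vr').2.
Qed.

(** The equivalence is relabeled to start at the word of [p] and realized by moves; the pair reached
    has composition [s'], hence is a relabeling of [q]. *)
Lemma ceq_class p q s s' wp wq : 2 <= #|A| -> valid p -> valid q ->
  (sumn s).+2 = #|A| -> ceq A s s' ->
  std s wp -> std s' wq -> rep p wp -> rep q wq ->
  forall l, nonlab_class q l -> nonlab_class p l.
Proof.
move=> n2 vp vq es [_ /(_ es) [w [w' [sw sw' h]]]] sp sq rp rq l ql.
have [f fi ef] := std_relabel sw sp.
have hw := weq_map f h; rewrite -ef in hw.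
have [p' pp' rp'] := weq_reach hw rp.
have [g gi eg] := std_relabel sq (std_map fi sw').
have [r pr e] : nonlab_class p' l.
  apply: (relabels_class n2 gi vq (valid_reach n2 pp' vp) _ ql) => a.
  case: rp' => [[_ ->] [_ ->]]; case: rq => [[_ ->] [_ ->]].
  by rewrite eg /= !index_map.
by exists r => //; apply: ext_reach_trans pp' pr.
Qed.

End Classes.
(** * Piece-wise order reversing pairs *)

Section Pwor.
Variables (A : finType) (p : pair A).
Local Notation n := #|A|.

Definition block lo hi := forall b : A,
  lo <= p.1 b < hi -> p.1 b + p.2 b = lo + hi - 1.

Fixpoint blocks (lo : nat) (s : seq nat) : Prop :=
  if s is k :: s' then [/\ 0 < k, block lo (lo + k) & blocks (lo + k) s']
  else lo = n.

Lemma block_sizes_cons lo hi ks :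
  block_sizes [:: lo, hi & ks] = hi - lo :: block_sizes (hi :: ks).
Proof.
rewrite /block_sizes /=; congr (_ :: _).
by rewrite -[1]/(1 + 0) iotaDl -map_comp; apply: eq_map.
Qed.

Lemma blocks_witness ks : pwor_witness p ks -> blocks 2 (block_sizes ks).
Proof.
case: ks => [|lo ks] [//= srt e2 ln h]; rewrite -[X in blocks X _]e2 {e2}.
elim: ks lo srt ln h => [|hi ks ih] lo.
  by move=> _ /= ->.
case/andP=> lh srt ln h; rewrite block_sizes_cons.
have e : lo + (hi - lo) = hi by rewrite subnKC // ltnW.
split; rewrite ?e ?subn_gt0 //.
  by move=> b; case: (h 0 isT b).
by apply: ih => // i hi' b; apply: (h i.+1).
Qed.

Lemma blocks_gt0 lo s : blocks lo s -> all (fun k => 0 < k) s.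
Proof. by elim: s lo => //= k s ih lo [-> _ /ih]. Qed.

Lemma blocks_sumn lo s : blocks lo s -> lo + sumn s = n.
Proof.
elim: s lo => [|k s ih] lo /=; first by rewrite addn0.
by case=> _ _ /ih; rewrite addnA.
Qed.

Lemma rev_iota lo k : rev (iota lo k) = [seq lo + (lo + k) - 1 - i | i <- iota lo k].
Proof.
apply: (@eq_from_nth _ 0); rewrite size_rev ?size_map // size_iota => i hi.
rewrite nth_rev ?size_iota // (nth_map 0) ?size_iota // !nth_iota //; lia.
Qed.

Lemma blocks_brev lo s u : blocks lo s -> map p.1 u = iota lo (sumn s) ->
  map p.2 (brev s u) = iota lo (sumn s).
Proof.
elim: s lo u => [|k s ih] lo u //= [k0 bl bs] e.
have : size u = k + sumn s by rewrite -(size_map p.1) e size_iota.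
case/split_word=> u1 [u2 [eu su1 su2]]; move: e; rewrite eu map_cat iotaD.
move/eqP; rewrite eqseq_cat ?size_map ?size_iota // => /andP [/eqP e1 /eqP e2].
rewrite brev_cons take_size_cat // drop_size_cat // map_cat (ih _ _ bs e2).
congr (_ ++ _); rewrite map_rev -[RHS]revK rev_iota -e1 -map_comp.
congr rev; apply/eq_in_map => a ha /=.
have : p.1 a \in iota lo k by rewrite -e1 map_f.
rewrite mem_iota => hp; have := bl a hp; lia.
Qed.

Hypotheses (n2 : 2 <= n) (pp : is_pair p) (ps : standard p).

Lemma blocks_std s : blocks 2 s -> exists2 w, std s w & rep p w.
Proof.
move=> bs; have en := blocks_sumn bs; have [t rt] := row_ex pp.1.
have [ft vt] := rt; have /andP [ut /eqP st] := ft; have mt := map_row rt.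
have st2 : size t = (sumn s).+2 by rewrite st -en.
have [a [v [et]]] := split_head st2.
case/split_last=> u [z [ev su]]; rewrite {}ev in et.
exists (a :: u ++ [:: z], z :: brev s u ++ [:: a]); first by split; rewrite -?et.
split; rewrite /= -?et //; apply: row_map.
have ei : iota 1 n = 1 :: iota 2 (sumn s) ++ [:: n].
  have e3 : n = (sumn s + 1).+1 by lia.
  rewrite {1}e3 -[LHS]/(1 :: iota 2 (sumn s + 1)) iotaD.
  by congr (_ :: _ ++ [:: _]); lia.
have eu : map p.1 u = iota 2 (sumn s).
  move: mt; rewrite et ei /= map_cat => -[_ /eqP].
  by rewrite eqseq_cat ?size_map ?size_iota // => /andP [/eqP].
rewrite /= map_cat (blocks_brev bs eu) /=.
have p1a : p.1 a = 1 by rewrite vt et /= eqxx.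
have p1z : p.1 z = n by apply: (@row_last _ _ (a :: u)); rewrite -cats1 /= -et.
have -> : p.2 z = 1 by apply/eqP; rewrite (ps z).2 p1z.
have -> : p.2 a = n by apply/eqP; rewrite -(ps a).1 p1a.
by rewrite ei.
Qed.

Variable x : nat -> A.
Hypothesis px : forall i, 1 <= i <= n -> p.1 (x i) = i.

Let i1 := pp.1.1.
Let i2 := pp.2.1.

Let p2x1 : p.2 (x 1) = n.
Proof. by apply/eqP; rewrite -(ps _).1 px //; lia. Qed.

Let p2xn : p.2 (x n) = 1.
Proof. by apply/eqP; rewrite (ps _).2 px //; lia. Qed.

(** The last top letter is first below, so the second clause of [Smap] concerns only the bottom
    position 2; beyond it the third clause applies. *)
Lemma Smap_step a b j : p.2 a = j.+1 -> 1 < j -> p.2 b = j -> p.1 b < n ->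
  Smap p a = x (p.1 b).+1.
Proof.
move=> pa j1 pb bn; rewrite /Smap pa (@invd_eq _ p.1 n (x n)) ?px //; try lia.
rewrite p2xn !eqSS; have -> : (j == 0) = false by lia.
have -> : (j == 1) = false by lia.
by rewrite /= (invd_eq _ i2 pb) (@invd_eq _ p.1 _ (x (p.1 b).+1)) // px; lia.
Qed.

Lemma Smap_first a : p.2 a = 2 -> Smap p a = x 2.
Proof.
move=> pa; rewrite /Smap pa (@invd_eq _ p.1 n (x n)) ?px //; try lia.
rewrite p2xn /= (invd_eq _ i2 p2x1) px; last by lia.
by rewrite (@invd_eq _ p.1 _ (x 2)) // px; lia.
Qed.

Lemma Smap_last a : p.2 a = 1 -> Smap p a = x 1.
Proof. by move=> pa; rewrite /Smap pa eqxx (@invd_eq _ p.1 _ (x 1)) // px; lia. Qed.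

Lemma Ymap_once a : p.1 a != 1 -> p.1 (Smap p a) != 1 -> Ymap p a = Smap p a.
Proof.
by move=> a1 s1; rewrite /Ymap (negPf a1) -(prednK (ltnW n2)) /= s1.
Qed.

Lemma Ymap_twice a : p.1 a != 1 -> p.1 (Smap p a) = 1 ->
  p.1 (Smap p (Smap p a)) != 1 -> Ymap p a = Smap p (Smap p a).
Proof.
move=> a1 s1 s2; rewrite /Ymap (negPf a1) -(subnKC n2) /= s1 eqxx /=.
by rewrite s2.
Qed.

(** Blocks being reversed, the bottom predecessor of [x i] is [x i.+1], whose top successor is
    [x i.+2]. The last letter of a block stands first in its bottom part, so its predecessor is the
    first letter [x pb] of the previous block, whence the return to [pb.+1]; this is the hypothesis
    on [lo] passed on to the next block. *)
Lemma blocks_yblocks s pb lo : 2 <= lo -> 0 < pb < lo ->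
  (forall a, p.2 a = lo -> Smap p a = x pb.+1) -> blocks lo s ->
  yblocks (Ymap p) x pb lo s.
Proof.
elim: s pb lo => [|k s ih] pb lo lo2 pblo back.
  move=> elo; have {elo}elo : lo = n := elo; rewrite /yblocks /yrel elo.
  apply/eqP.
  (* The only place where Y differs from S: the excluded letter [x 1] is skipped. *)
  have e1 : Smap p (x n) = x 1 by apply: Smap_last.
  have e2 : Smap p (x 1) = x pb.+1 by apply: back; rewrite elo.
  by rewrite Ymap_twice ?e1 ?e2 // ?px //; lia.
case=> k0 bl bs; have en := blocks_sumn bs.
have p2i i : lo <= i < lo + k -> p.2 (x i) = lo + (lo + k) - 1 - i.
  move=> hi; have := bl (x i); rewrite px; last by lia.
  by move=> /(_ hi); lia.
split=> //.
- move=> i li ik; apply/eqP.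
  have e : Smap p (x i) = x i.+2.
    rewrite (@Smap_step _ (x i.+1) (lo + (lo + k) - 1 - i.+1)) ?p2i ?px //; lia.
  by rewrite Ymap_once ?e // px; lia.
- apply/eqP; have e : Smap p (x (lo + k).-1) = x pb.+1.
    by apply: back; rewrite p2i; lia.
  by rewrite Ymap_once ?e // px; lia.
apply: ih => //; try lia; move=> a pa.
by rewrite (@Smap_step _ (x lo) (lo + k).-1) ?p2i ?px //; lia.
Qed.

(** With [pb = 1] the excursion from position 2 returns to position 2, so it is a cycle too and
    accounts for the first entry of [pc s]. *)
Lemma cycle_lengths_pc s : blocks 2 s -> perm_eq (cycle_lengths p) (pc s).
Proof.
move=> bs; have en := blocks_sumn bs.
have yb : yblocks (Ymap p) x 1 2 s.
  by apply: blocks_yblocks => //; exact: Smap_first.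
have [l [cls [pe pae lae cc [sl scl]]]] := excursion yb.
set css := (2 :: l) :: cls.
have flE : flatten css = (2 :: l) ++ flatten cls by [].
have pfl : perm_eq (flatten css) (iota 2 (sumn s).+1) by rewrite flE.
have -> : pc s = map size (map (map x) css).
  rewrite -map_comp /pc -sl -scl /= size_map; congr (_ :: _).
  by apply: eq_map => c /=; rewrite size_map.
have xi : {in flatten css &, injective x}.
  move=> i j; rewrite !(perm_mem pfl) !mem_iota => hi hj /(congr1 p.1).
  by rewrite !px //; lia.
apply: (@cycle_orders A (Ymap p) (fun a => p.1 a != 1)).
- have: all (fun c => (c != [::]) && cycle (yrel (Ymap p) x) c) css.
    by rewrite /= rcons_path pae lae cc.
  rewrite all_map; apply: sub_all => c /andP [nc cyc]; rewrite /= cycle_map.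
  by rewrite -size_eq0 size_map size_eq0 nc.
- by rewrite -map_flatten map_inj_in_uniq // (perm_uniq pfl) iota_uniq.
move=> a; rewrite -map_flatten [RHS]/(p.1 a != 1).
apply/mapP/idP => [[i]|a1].
  rewrite (perm_mem pfl) mem_iota => hi ->.
  by have ni : p.1 (x i) != 1 by rewrite px; lia.
have {}a1 : p.1 a != 1 := a1.
have [_ /(_ a) ha] := pp.1; exists (p.1 a); last by apply: i1; rewrite px.
by rewrite (perm_mem pfl) mem_iota; lia.
Qed.

End Pwor.

Theorem theorem4p6 (A : finType) (p q : pair A) :
  2 <= #|A| ->
  is_pair p -> is_pair q ->
  irreducible p -> irreducible q ->
  (exists t : PType, pwor_of_type p t /\ pwor_of_type q t) ->
  perm_eq (cycle_lengths p) (cycle_lengths q) ->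
  forall s : seq nat, nonlab_class p s <-> nonlab_class q s.
Proof.
move=> n2 pp pq ip iq [t [[sp [ks wp tp]] [sq [ks' wq tq]]]] pe.
have bp := blocks_witness wp; have bq := blocks_witness wq.
have ep := blocks_sumn bp; have eq := blocks_sumn bq.
have letters (r : pair A) : is_pair r ->
    exists x : nat -> A, forall i, 1 <= i <= #|A| -> r.1 (x i) = i.
  case=> /row_ex [[|a l] rl] _; first by case: rl => /andP [_ /eqP e]; rewrite -e in n2.
  exists (fun i => nth a (a :: l) i.-1) => i hi.
  have [/andP [ul /eqP sl] ->] := rl; rewrite index_uniq // ?sl; lia.
have [x px] := letters p pp; have [y py] := letters q pq.
have c : ceq A (block_sizes ks) (block_sizes ks').
  apply: (ceq_type A (blocks_gt0 bp) (blocks_gt0 bq) _ tp tq); first by lia.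
  rewrite -(permPl (cycle_lengths_pc n2 pp sp px bp)).
  by rewrite -(permPr (cycle_lengths_pc n2 pq sq py bq)).
have [wp' sdp rp] := blocks_std n2 pp sp bp.
have [wq' sdq rq] := blocks_std n2 pq sq bq.
have vp : valid p by split.
have vq : valid q by split.
move=> s; split.
  exact: (ceq_class n2 vq vp eq (ceq_sym c) sdq sdp rq rp).
exact: (ceq_class n2 vp vq ep c sdp sdq rp rq).
Qed.
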